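(* Let $n\ge4$ be fixed and let $p\wedge q\to\infty$. Suppose that there are constants $a,b,a',b'$ not depending on $p,q$ with $0<a\le\inf_i \mathrm{var}(x_i)\le\sup_iE(x_i^2)\le b<\infty$ and $0<a'\le\inf_j \mathrm{var}(y_j)\le\sup_jE(y_j^2)\le b'<\infty$. (i) One has $$\tau\times hCov_n^2(\mathbf X,\mathbf Y)=f^{(1)}\!\left(\frac{\tau_X}{\gamma_{\mathbf X}}\right)g^{(1)}\!\left(\frac{\tau_Y}{\gamma_{\mathbf Y}}\right)\frac{\tau_X}{\gamma_{\mathbf X}}\frac{\tau_Y}{\gamma_{\mathbf Y}}\,\frac1\tau\sum_{i=1}^p\sum_{j=1}^q\mathrm{cov}_n^2(\mathcal X_i,\mathcal Y_j)+\mathcal R_n,$$ where $\mathcal R_n$ is the remainder term. (ii) Suppose further that $L_X(X,X')=O_p(a_p)$ and $L_Y(Y,Y')=O_p(b_q)$, where $a_p,b_q$ are sequences of numbers with $a_p=o(1)$, $b_q=o(1)$, $\tau_X^2a_p^3=o(1)$, $\tau_Y^2b_q^3=o(1)$, $\tau a_p^2b_q=o(1)$, $\tau a_pb_q^2=o(1)$. Then $$f^{(1)}\!\left(\frac{\tau_X}{\gamma_{\mathbf X}}\right)g^{(1)}\!\left(\frac{\tau_Y}{\gamma_{\mathbf Y}}\right)\frac{\tau_X}{\gamma_{\mathbf X}}\frac{\tau_Y}{\gamma_{\mathbf Y}}\asymp_p1,\qquad \frac1\tau\sum_{i=1}^p\sum_{j=1}^q\mathrm{cov}_n^2(\mathcal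 X_i,\mathcal Y_j)=O_p(\tau a_pb_q),$$ $$\mathcal R_n=O_p(\tau a_p^2b_q+\tau a_pb_q^2)=o_p(1).$$ Thus the remainder term is of smaller order compared to the leading term and is therefore asymptotically negligible.
   Context: Setting. For each $p,q$, $(X,Y)$ is a pair of random vectors $X=(x_1,\dots,x_p)^T\in\mathbb R^p$, $Y=(y_1,\dots,y_q)^T\in\mathbb R^q$. $(X_1,Y_1),\dots,(X_n,Y_n)$ are i.i.d. copies of $(X,Y)$, with $X_s=(x_{s1},\dots,x_{sp})^T$, $Y_s=(y_{s1},\dots,y_{sq})^T$. $\mathbf X=(X_1,\dots,X_n)^T$, $\mathbf Y=(Y_1,\dots,Y_n)^T$; $\mathcal X_i=(x_{1i},\dots,x_{ni})^T$, $\mathcal Y_j=(y_{1j},\dots,y_{nj})^T$. $|\cdot|$ is the Euclidean norm; $(X',Y')$ is an independent copy of $(X,Y)$. For random $Z_s$ and numbers $a_s$, $Z_s\asymp_pa_s$ means $Z_s/a_s=O_p(1)$ and $a_s/Z_s=O_p(1)$. $\mathcal U$-centering. For any matrix $\mathbf A=(a_{st})\in\mathbb R^{n\times n}$, $\widetilde{\mathbf A}=(\tilde a_{st})$ has $\tilde a_{ss}=0$ and, for $s\neq t$, $\tilde a_{st}=a_{st}-\frac1{n-2}\sum_{v=1}^na_{sv}-\frac1{n-2}\sum_{u=1}^na_{ut}+\frac1{(n-1)(n-2)}\sum_{u,v=1}^na_{uv}$; $(\widetilde{\mathbf A}\cdot\widetilde{\mathbf B})=\frac1{n(n-3)}\sum_{s\ne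 t}\tilde a_{st}\tilde b_{st}$. Kernels: the kernels considered are those of the form $K(x,y)=f(|x-y|/\gamma)$ and $L(x,y)=g(|x-y|/\gamma)$, with $\gamma$ a bandwidth parameter, for some continuously differentiable functions $f,g$ with derivatives $f^{(1)},g^{(1)}$; examples are the Gaussian kernel, $f(a)=\exp(-a^2/2)$, and the Laplacian kernel, $f(a)=\exp(-a)$. Sample Hilbert–Schmidt covariance: $hCov_n^2(\mathbf X,\mathbf Y)=(\widetilde{\mathbf R}\cdot\widetilde{\mathbf H})$, where $\mathbf R=(r_{st})_{s,t=1}^n$, $\mathbf H=(h_{st})_{s,t=1}^n$, $r_{st}=f(|X_s-X_t|/\gamma_{\mathbf X})$, $h_{st}=g(|Y_s-Y_t|/\gamma_{\mathbf Y})$, with $\gamma_{\mathbf X}=\mathrm{median}\{|X_s-X_t|:s\ne t\}$, $\gamma_{\mathbf Y}=\mathrm{median}\{|Y_s-Y_t|:s\ne t\}$. $\mathrm{cov}_n^2(\mathcal X_i,\mathcal Y_j)=\binom n4^{-1}\sum_{s<t<u<v}\frac1{4!}\sum_*\frac14(x_{si}-x_{ti})(y_{sj}-y_{tj})(x_{ui}-x_{vi})(y_{uj}-y_{vj})$, where $\sum_*$ is over all permutations of the 4-tuple of indices $(s,t,u,v)$. Notation: $\tau_X^2=E|X-X'|^2$, $\tau_Y^2=E|Y-Y'|^2$, $\tau=\tau_X\tau_Y$ (positive roots); $L_X(X,X')=\frac{|X-X'|^2-\tau_X^2}{\tau_X^2}$, $L_Y(Y,Y')=\frac{|Y-Y'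|^2-\tau_Y^2}{\tau_Y^2}$.
   Formalization: R and H are taken with zero diagonal (f(0), g(0) there would make R_n diverge); the factor ≍_p 1 is claimed only if f'(1), g'(1) ≠ 0; the R_n bounds assume f'(x)−f'(1)=O(x−1) at 1, likewise g, as they fail for merely C¹ kernels; the rates a_p, b_q are taken ≥ 0. *)

(* Defs.v *)
From HB Require Import structures.
From mathcomp Require Import all_boot all_order all_algebra all_fingroup.
From mathcomp Require Import all_classical all_reals all_analysis.
Import Order.TTheory GRing.Theory Num.Theory numFieldNormedType.Exports.

Set Implicit Arguments.
Unset Strict Implicit.
Unset Printing Implicit Defensive.

Local Open Scope classical_set_scope.
Local Open Scope ring_scope.

Section Sample.
Context {R : realType}.

(* The norm [`| _ |] of the library on vectors is the sup norm, hence this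
   separate Euclidean distance. *)
Definition edist (p : nat) (x y : p.-tuple R) : R :=
  Num.sqrt (\sum_(i < p) (tnth x i - tnth y i) ^+ 2).

(* The two middle order statistics coincide when [size s] is odd. *)
Definition median (s : seq R) : R :=
  let t := sort <=%R s in
  (t`_((size t).-1./2) + t`_((size t)./2)) / 2.

Definition bandwidth (n p : nat) (x : 'I_n -> p.-tuple R) : R :=
  median [seq edist (x st.1) (x st.2) |
           st <- enum {: 'I_n * 'I_n} & st.1 != st.2].

Definition ucenter (n : nat) (A : 'M[R]_n) : 'M[R]_n :=
  \matrix_(s, t)
    if s == t then 0 else
      A s t - (n%:R - 2)^-1 * (\sum_v A s v)
            - (n%:R - 2)^-1 * (\sum_u A u t)
            + ((n%:R - 1) * (n%:R - 2))^-1 * (\sum_u \sum_v A u v).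

Definition udot (n : nat) (A B : 'M[R]_n) : R :=
  (n%:R * (n%:R - 3))^-1 * \sum_s \sum_(t | s != t) A s t * B s t.

(* The diagonal is 0 and not [f 0], as for the distance matrices that
   U-centering was designed for. With [f 0] and [g 0] on the diagonals,
   [hcov2] below would be shifted by the constant
   [f 0 * g 0 / ((n - 1) * (n - 3))]. *)
Definition kernel_mx (n p : nat) (f : R -> R) (x : 'I_n -> p.-tuple R) :
    'M[R]_n :=
  \matrix_(s, t)
    if s == t then 0 else f (edist (x s) (x t) / bandwidth x).

Definition hcov2 (n p q : nat) (f g : R -> R)
    (x : 'I_n -> p.-tuple R) (y : 'I_n -> q.-tuple R) : R :=
  udot (ucenter (kernel_mx f x)) (ucenter (kernel_mx g y)).

Definition cov2 (n : nat) (x y : 'I_n -> R) : R :=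
  ('C(n, 4))%:R^-1 *
  \sum_(s < n) \sum_(t < n | (s < t)%N)
  \sum_(u < n | (t < u)%N) \sum_(v < n | (u < v)%N)
    ((4`!)%:R^-1 *
     \sum_(sigma : 'S_4)
       let w k := tnth [tuple s; t; u; v] (sigma (inord k)) in
       4^-1 * (x (w 0%N) - x (w 1%N)) * (y (w 0%N) - y (w 1%N))
            * (x (w 2%N) - x (w 3%N)) * (y (w 2%N) - y (w 3%N))).

(* [f' x = f' 1 + O(x - 1)] as [x] tends to 1; it holds in particular when
   [f] is twice differentiable at 1. *)
Definition deriv_lipschitz_at1 (f : R -> R) : Prop :=
  exists C : R, \forall x \near (1 : R),
    `|derive1 f x - derive1 f 1| <= C * `|x - 1|.

End Sample.

Section Independence.
Context {d d' : measure_display} {T : measurableType d}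
  {T' : measurableType d'} {R : realType} (P : probability T R).

Definition independent_copy (Z Z' : {RV P >-> T'}) : Prop :=
  (forall A, measurable A -> P (Z' @^-1` A) = P (Z @^-1` A)) /\
  (forall A B, measurable A -> measurable B ->
     P (Z @^-1` A `&` Z' @^-1` B) = (P (Z @^-1` A) * P (Z' @^-1` B))%E).

(* Some of the [A s] may be [setT], so the product rule for the full family
   gives it for every subfamily. *)
Definition iid_copies (n : nat) (Z : {RV P >-> T'})
    (S : 'I_n -> {RV P >-> T'}) : Prop :=
  (forall s A, measurable A -> P (S s @^-1` A) = P (Z @^-1` A)) /\
  (forall A : 'I_n -> set T', (forall s, measurable (A s)) ->
     P (\bigcap_(s in [set: 'I_n]) (S s @^-1` A s)) =
       (\prod_(s < n) P (S s @^-1` A s))%E).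

End Independence.

(* [pop] is (X, Y), [copy] is (X', Y') and [sample s] is (X_s, Y_s). *)
Record model (R : realType) (n p q : nat) := Model {
  disp : measure_display;
  Omega : measurableType disp;
  Pr : probability Omega R;
  pop : {RV Pr >-> (p.-tuple R * q.-tuple R)%type};
  copy : {RV Pr >-> (p.-tuple R * q.-tuple R)%type};
  sample : 'I_n -> {RV Pr >-> (p.-tuple R * q.-tuple R)%type};
  copyP : independent_copy pop copy;
  sampleP : iid_copies pop sample
}.

Section Model.
Context {R : realType} {n p q : nat} (M : model R n p q).

Definition coordX (i : 'I_p) (w : Omega M) : R := tnth (pop M w).1 i.
Definition coordY (j : 'I_q) (w : Omega M) : R := tnth (pop M w).2 j.

Definition distX (w : Omega M) : R := edist (pop M w).1 (copy M w).1.
Definition distY (w : Omega M) : R := edist (pop M w).2 (copy M w).2.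

Definition tauX : R := Num.sqrt (fine 'E_(Pr M)[(fun w => distX w ^+ 2)%R]%E).
Definition tauY : R := Num.sqrt (fine 'E_(Pr M)[(fun w => distY w ^+ 2)%R]%E).
Definition tau : R := tauX * tauY.

Definition LX (w : Omega M) : R := (distX w ^+ 2 - tauX ^+ 2) / tauX ^+ 2.
Definition LY (w : Omega M) : R := (distY w ^+ 2 - tauY ^+ 2) / tauY ^+ 2.

Definition sampleX (w : Omega M) (s : 'I_n) : p.-tuple R := (sample M s w).1.
Definition sampleY (w : Omega M) (s : 'I_n) : q.-tuple R := (sample M s w).2.

Definition hCov2 (f g : R -> R) (w : Omega M) : R :=
  hcov2 f g (sampleX w) (sampleY w).

Definition derivative_factor (f g : R -> R) (w : Omega M) : R :=
  let cX := tauX / bandwidth (sampleX w) in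
  let cY := tauY / bandwidth (sampleY w) in
  derive1 f cX * derive1 g cY * cX * cY.

Definition scaled_cov_sum (w : Omega M) : R :=
  tau^-1 * \sum_(i < p) \sum_(j < q)
    cov2 (fun s => tnth (sampleX w s) i) (fun s => tnth (sampleY w s) j).

End Model.

Arguments coordX {R n p q} M i w.
Arguments coordY {R n p q} M j w.
Arguments LX {R n p q} M w.
Arguments LY {R n p q} M w.
Arguments hCov2 {R n p q} M f g w.
Arguments derivative_factor {R n p q} M f g w.
Arguments scaled_cov_sum {R n p q} M w.

(* The limit p /\ q -> oo: a property is eventual iff it holds for all p, q
   larger than some N. *)
Definition pq_oo : set_system (nat * nat) := filter_prod \oo \oo.

Section StochasticOrder.
Context {R : realType} {n : nat} (M : forall p q, model R n p q).
Variables (Z : forall p q, Omega (M p q) -> R) (a : nat -> nat -> R).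

(* [Z / a] is bounded by [C] in the form [`|Z| <= C * `|a|]. *)
Definition bigOp : Prop :=
  forall e : R, 0 < e -> exists C : R, \forall pq \near pq_oo,
    (Pr (M pq.1 pq.2)
       [set w | (C * `|a pq.1 pq.2| < `|Z w|)%R ] <= e%:E)%E.

Definition littleop : Prop :=
  forall e : R, 0 < e ->
    Pr (M pq.1 pq.2) [set w | e * `|a pq.1 pq.2| < `|Z w| ]
      @[pq --> pq_oo] --> 0%E.

(* [a / Z] is bounded in the form [`|a| <= C * `|Z|], so that [Z = 0] counts
   as unbounded, whereas [a / 0] is [0] in the library. *)
Definition asymp_p : Prop :=
  bigOp /\
  forall e : R, 0 < e -> exists C : R, \forall pq \near pq_oo,
    (Pr (M pq.1 pq.2)
       [set w | (C * `|Z w| < `|a pq.1 pq.2|)%R ] <= e%:E)%E.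

End StochasticOrder.

Arguments bigOp {R n} M Z a.
Arguments littleop {R n} M Z a.
Arguments asymp_p {R n} M Z a.

(* Main.v *)
Require Import Defs.
From HB Require Import structures.
From mathcomp Require Import all_boot all_order all_algebra all_fingroup.
From mathcomp Require Import all_classical all_reals all_analysis.
From mathcomp Require Import measurable_realfun ring lra.
Import Order.TTheory GRing.Theory Num.Theory numFieldNormedType.Exports.

(* Write [L_st] for [L_X (X_s, X_t)]. For [s != t] the pair [(X_s, X_t)] has the
   law of [(X, X')], so with probability close to 1 all the finitely many
   [L_st] are at most [C * a_p] in absolute value, and likewise for Y. On that
   event the argument is deterministic: every ratio [|X_s - X_t| / tau_X] is
   within [C * a_p] of 1, hence so is the ratio of the median to [tau_X], and
   with [c := tau_X / gamma_X] the mean value theorem gives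
     [f (|X_s - X_t| / gamma_X) = f c + c * f' c / 2 * L_st + O(a_p ^ 2)].
   U-centering is linear and kills the constant [f c], so that the product
   [(R~ . H~)] is [1/4] of the derivative factor times [(L~_X . L~_Y)] up to
   [O(a_p ^ 2 * b_q + a_p * b_q ^ 2)]. Finally [L_X] is, up to an additive
   constant and a factor [tau_X ^ 2], the sum over the coordinates of the
   squared differences, and [cov2 x y] is exactly [1/4] of the U-centered
   product of the matrices [(x_s - x_t) ^ 2] and [(y_s - y_t) ^ 2]. *)

Set Implicit Arguments.
Unset Strict Implicit.
Unset Printing Implicit Defensive.

Local Open Scope classical_set_scope.
Local Open Scope ring_scope.

(** * The sample covariance as a U-centered product *)

Section PermSums.

(** Acts on positions by precomposition, as [cov2] reads its four indices through [sigma]; hence the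
    reversed product in [permtM]. *)
Definition permt (k : nat) (T : Type) (q : k.-tuple T) (s : 'S_k) : k.-tuple T :=
  [tuple tnth q (s i) | i < k].

Lemma permtM k T (q : k.-tuple T) (s u : 'S_k) :
  permt (permt q s) u = permt q (u * s)%g.
Proof. by apply: eq_from_tnth => i; rewrite !tnth_mktuple permM. Qed.

Lemma permt1 k T (q : k.-tuple T) : permt q 1%g = q.
Proof. by apply: eq_from_tnth => i; rewrite !tnth_mktuple perm1. Qed.

Lemma perm_permt k (T : eqType) (q : k.-tuple T) s : perm_eq (permt q s) q.
Proof. by apply/tuple_permP; exists s. Qed.

Lemma permt_inj k (T : eqType) (q : k.-tuple T) : uniq q -> injective (permt q).
Proof.
move=> /tuple_uniqP qi s u qsu; apply/permP => i; apply: qi.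
by have := congr1 (fun t => tnth t i) qsu; rewrite !tnth_mktuple.
Qed.

(** A duplicate-free tuple arises from exactly one increasing tuple by exactly one permutation of
    positions. *)
Lemma sum_sorted_perm (V : nmodType) (n k : nat) (F : k.-tuple 'I_n -> V) :
  \sum_(q : k.-tuple 'I_n | sorted <%O q) \sum_(s : 'S_k) F (permt q s) =
  \sum_(q : k.-tuple 'I_n | uniq q) F q.
Proof.
have ex (q : k.-tuple 'I_n) : uniq q -> exists s, sorted <%O (permt q s).
  move=> uq; have /tuple_permP[s qs] : perm_eq (sort_tuple <=%O q) q.
    by rewrite perm_sort.
  exists s; rewrite /permt -qs lt_sorted_uniq_le sort_uniq uq /=.
  exact: sort_le_sorted.
rewrite (exchange_big_dep xpredT) //=.
(* [F q] is spread over the permutations that sort [q]; for duplicate-free [q] there is exactly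
   one. *)
rewrite [RHS](eq_bigr (fun q => \sum_(s : 'S_k | sorted <%O (permt q s)) F q)).
  rewrite [RHS](exchange_big_dep xpredT) // [RHS](reindex_inj invg_inj).
  (* Permuting by [s] maps the increasing tuples bijectively onto the duplicate-free tuples that
     [s^-1] sorts. *)
  apply: eq_bigr => s _; rewrite [RHS](reindex_onto (fun q => permt q s) (fun q => permt q s^-1%g)).
    apply: eq_bigl => q; rewrite permtM mulVg permt1 eqxx !andbT andbC.
    by rewrite (perm_uniq (perm_permt q s)) lt_sorted_uniq_le; case: (uniq q); rewrite ?andbT.
  by move=> q _; rewrite permtM mulgV permt1.
move=> q uq; have [s0 s0P] := ex q uq.
rewrite (bigD1 s0) //= big1 ?addr0 // => s /andP[sP /eqP[]].
(* Two increasing tuples with the same entries are equal. *)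
apply: (permt_inj uq); apply: val_inj; apply: lt_sorted_eq => // i.
by rewrite (perm_mem (perm_permt q s)) (perm_mem (perm_permt q s0)).
Qed.

Lemma sum_tuple4 (V : nmodType) (I : finType) (P : pred (4.-tuple I))
    (F : 4.-tuple I -> V) :
  \sum_(q : 4.-tuple I | P q) F q =
  \sum_s \sum_t \sum_u \sum_v
    if P [tuple s; t; u; v] then F [tuple s; t; u; v] else 0.
Proof.
pose h (r : I * I * I * I) := [tuple r.1.1.1; r.1.1.2; r.1.2; r.2].
have hK : bijective h.
  exists (fun q : 4.-tuple I => (tnth q (inord 0), tnth q (inord 1), tnth q (inord 2),
     tnth q (inord 3))).
    move=> [[[s t] u] v] /=; rewrite /h /=.
    by congr (_, _, _, _); rewrite (tnth_nth s) inordK.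
  move=> q; apply: eq_from_tnth => i; rewrite /h.
  rewrite (tnth_nth (tnth q i)) /=.
  case: i => -[|[|[|[|//]]]] ip /=; congr tnth; apply: val_inj; rewrite /= inordK //.
rewrite big_mkcond (reindex h) /=; last exact: onW_bij.
rewrite pair_big pair_big pair_big /=.
by apply: eq_bigr => -[[[s t] u] v].
Qed.


(** This is [sum_sorted_perm] for [k = 4], unfolded into the nested sums in which [cov2] is
    written. *)
Lemma sum_increasing4 (V : nmodType) (n : nat) (F : 4.-tuple 'I_n -> V) :
  \sum_(s < n) \sum_(t < n | (s < t)%N) \sum_(u < n | (t < u)%N)
    \sum_(v < n | (u < v)%N) \sum_(sigma : 'S_4)
      F (permt [tuple s; t; u; v] sigma) =
  \sum_(s < n) \sum_(t < n | t != s) \sum_(u < n | (u != s) && (u != t))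
    \sum_(v < n | [&& v != s, v != t & v != u]) F [tuple s; t; u; v].
Proof.
transitivity (\sum_(q : 4.-tuple 'I_n | sorted <%O q)
    \sum_(sigma : 'S_4) F (permt q sigma)).
  rewrite sum_tuple4; apply: eq_bigr => s _.
  rewrite big_mkcond; apply: eq_bigr => t _; rewrite /= ltEord.
  case: ifP => _ /=; last by rewrite big1 // => u _; rewrite big1.
  rewrite big_mkcond; apply: eq_bigr => u _ /=.
  case: ifP => _ /=; last by rewrite big1.
  by rewrite big_mkcond; apply: eq_bigr => v _; rewrite andbT.
rewrite sum_sorted_perm sum_tuple4; apply: eq_bigr => s _.
rewrite [RHS]big_mkcond; apply: eq_bigr => t _ /=.
case: (eqVneq t s) => [->|ts] /=.
  by rewrite big1 // => u _; rewrite big1 // => v _; rewrite inE eqxx.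
rewrite [RHS]big_mkcond; apply: eq_bigr => u _ /=.
case: (eqVneq u s) => [->|us] /=; first by rewrite big1 // => v _; rewrite !inE eqxx orbT.
case: (eqVneq u t) => [->|ut] /=.
  by rewrite big1 // => v _; rewrite !inE eqxx andbF.
rewrite [RHS]big_mkcond; apply: eq_bigr => v _ /=.
rewrite !inE (eq_sym s t) (eq_sym s u) (eq_sym s v) (eq_sym t u) (eq_sym t v) (eq_sym u v).
by rewrite (negPf ts) (negPf us) (negPf ut) /= andbT.
Qed.

End PermSums.

(** * U-centering of symmetric matrices with zero diagonal, and squared differences *)

Section CovarianceIdentity.
Variables (R : realType) (n : nat).
Implicit Types (x y : 'I_n -> R) (k : 'I_n -> 'I_n -> R) (A B : 'M[R]_n).

(* Inclusion-exclusion on the coincidences between [{s, t}] and [{u, v}]. *)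
Lemma sum_distinct4 k (k0 : forall s, k s s = 0) (kC : forall s t, k s t = k t s) :
  \sum_(s < n) \sum_(t < n | t != s) \sum_(u < n | (u != s) && (u != t))
    \sum_(v < n | [&& v != s, v != t & v != u]) k s t * k u v =
  (\sum_s \sum_t k s t) ^+ 2 - 4 * (\sum_s (\sum_t k s t) ^+ 2) +
  2 * \sum_s \sum_t k s t ^+ 2.
Proof.
pose r s := \sum_t k s t; pose S := \sum_s r s.
(* The row sum of [u] loses the columns [s] and [t]; the column [u] contributes [k u u = 0]. *)
have inner s t u : t != s -> u != s -> u != t ->
    \sum_(v < n | [&& v != s, v != t & v != u]) k u v = r u - k u s - k u t.
  move=> ts us ut; rewrite /r [X in _ = X - _ - _](bigD1 s) //=.
  rewrite [X in _ = _ + X - _ - _](bigD1 t) //=.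
  rewrite [X in _ = _ + (_ + X) - _ - _](bigD1 u) /=; last by rewrite us ut.
  under [X in _ = _ + (_ + (_ + X)) - _ - _]eq_bigl do rewrite -andbA.
  by rewrite k0; ring.
(* From the sum over all [u], the terms [u = s] and [u = t] are removed; they equal [r s - k s t]
   and [r t - k s t]. *)
have mid s t : t != s ->
    \sum_(u < n | (u != s) && (u != t)) (r u - k u s - k u t) =
    S - 2 * r s - 2 * r t + 2 * k s t.
  move=> ts.
  have : \sum_u (r u - k u s - k u t) = S - r s - r t.
    rewrite !sumrB; congr (_ - _ - _); apply: eq_bigr => i _; exact: kC.
  rewrite (bigD1 s) //= (bigD1 t) //= !k0 (kC t s) => /eqP.
  rewrite eq_sym addrA addrC -subr_eq => /eqP <-; ring.
transitivity (\sum_s \sum_t k s t * (S - 2 * r s - 2 * r t + 2 * k s t)).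
  apply: eq_bigr => s _; rewrite [RHS](bigD1 s) //= k0 mul0r add0r.
  apply: eq_bigr => t ts; rewrite -mid // mulr_sumr; apply: eq_bigr => u /andP[us ut].
  by rewrite -mulr_sumr inner.
have -> : S ^+ 2 = \sum_s \sum_t k s t * S.
  rewrite expr2 mulr_suml; apply: eq_bigr => s _; by rewrite mulr_suml.
have sr : \sum_s r s ^+ 2 = \sum_s \sum_t k s t * r s.
  by apply: eq_bigr => s _; rewrite expr2 {1}/r mulr_suml.
have sr' : \sum_s r s ^+ 2 = \sum_s \sum_t k s t * r t.
  rewrite sr exchange_big /=; apply: eq_bigr => s _; apply: eq_bigr => t _.
  by rewrite kC.
rewrite -/S; have -> : 4 * (\sum_s r s ^+ 2) =
    2 * (\sum_s \sum_t k s t * r s) + 2 * (\sum_s \sum_t k s t * r t).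
  by rewrite -sr -sr'; ring.
transitivity (\sum_s \sum_t (k s t * S - 2 * (k s t * r s)
  - 2 * (k s t * r t) + 2 * k s t ^+ 2)).
  by apply: eq_bigr => s _; apply: eq_bigr => t _; ring.
under eq_bigr do rewrite big_split !sumrB -!mulr_sumr /=.
by rewrite big_split !sumrB -!mulr_sumr /=; ring.
Qed.

Lemma ucenter_diag A s : ucenter A s s = 0.
Proof. by rewrite mxE eqxx. Qed.

Lemma ucenter_offdiag A s t (A_sym : forall s t, A s t = A t s) : s != t ->
  ucenter A s t = A s t - (n%:R - 2)^-1 * (\sum_v A s v)
    - (n%:R - 2)^-1 * (\sum_v A t v)
    + ((n%:R - 1) * (n%:R - 2))^-1 * (\sum_u \sum_v A u v).
Proof.
move=> st; rewrite mxE (negPf st).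
by congr (_ - _ * _ + _); apply: eq_bigr => v _; rewrite A_sym.
Qed.

Lemma ucenter_sym A (A_sym : forall s t, A s t = A t s) s t :
  ucenter A s t = ucenter A t s.
Proof.
case: (eqVneq s t) => [->//|st].
by rewrite !ucenter_offdiag // 1?eq_sym // A_sym; ring.
Qed.

(** With row sum [r] and total [S], the row adds up to [r - (n-1)/(n-2) r - (S - r)/(n-2) + S/(n-2)
    = 0]; the zero diagonal makes [r] the sum of the off-diagonal entries. *)
Lemma row_sum_ucenter A (n_gt2 : (2 < n)%N) (A_sym : forall s t, A s t = A t s)
  (A0 : forall s, A s s = 0) s : \sum_t ucenter A s t = 0.
Proof.
have n2 : n%:R - 2 != 0 :> R by rewrite subr_eq0 (eqr_nat R n 2) gtn_eqF.
have n1 : n%:R - 1 != 0 :> R by rewrite subr_eq0 (eqr_nat R n 1) gtn_eqF // ltnW.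
pose r s := \sum_v A s v; pose S := \sum_u r u.
rewrite (bigD1 s) //= ucenter_diag add0r.
rewrite (eq_bigr (fun t => A s t - (n%:R - 2)^-1 * r s - (n%:R - 2)^-1 * r t +
    ((n%:R - 1) * (n%:R - 2))^-1 * S)); last first.
  by move=> t ts; rewrite ucenter_offdiag // eq_sym.
(* The off-diagonal formula is summed over all [t], and its spurious value at [t = s] is subtracted
   afterwards. *)
have : \sum_t (A s t - (n%:R - 2)^-1 * r s - (n%:R - 2)^-1 * r t +
    ((n%:R - 1) * (n%:R - 2))^-1 * S) = r s - n%:R * ((n%:R - 2)^-1 * r s) -
    (n%:R - 2)^-1 * S + n%:R * (((n%:R - 1) * (n%:R - 2))^-1 * S).
  rewrite big_split !sumrB /= -mulr_sumr !sumr_const card_ord.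
  by rewrite -[r s *+ n]mulr_natl -[(_ * S) *+ n]mulr_natl -mulr_sumr -/S -/(r s); ring.
rewrite (bigD1 s) //= A0 => /eqP.
rewrite eq_sym addrC -subr_eq => /eqP <-.
by field; rewrite n1 n2.
Qed.

(** A U-centered matrix has vanishing row and column sums, so it is orthogonal to everything that
    centering adds to the other factor; only one factor then has to be expanded. *)
Lemma udot_ucenter A B (n_gt2 : (2 < n)%N)
  (A_sym : forall s t, A s t = A t s) (A0 : forall s, A s s = 0)
  (B_sym : forall s t, B s t = B t s) (B0 : forall s, B s s = 0) :
  udot (ucenter A) (ucenter B) = (n%:R * (n%:R - 3))^-1 *
    ((\sum_s \sum_t A s t * B s t)
     - 2 * (n%:R - 2)^-1 * (\sum_s (\sum_t A s t) * (\sum_t B s t))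
     + ((n%:R - 1) * (n%:R - 2))^-1 *
       ((\sum_s \sum_t A s t) * (\sum_s \sum_t B s t))).
Proof.
rewrite /udot; congr (_ * _).
pose a s := \sum_t A s t; pose b s := \sum_t B s t.
pose SA := \sum_s a s; pose SB := \sum_s b s.
set al := (n%:R - 2)^-1; set be := ((n%:R - 1) * (n%:R - 2))^-1.
have rA := row_sum_ucenter n_gt2 A_sym A0.
(* First the centering of [B] is dropped, by the zero row and column sums of [ucenter A]. *)
transitivity (\sum_s \sum_t ucenter A s t * B s t).
  transitivity (\sum_s \sum_t (ucenter A s t * B s t - al * b s * ucenter A s t
     - al * (ucenter A s t * b t) + be * SB * ucenter A s t)).
    apply: eq_bigr => s _; rewrite [RHS](bigD1 s) //= !ucenter_diag.
    rewrite !mul0r !mulr0 !subr0 !add0r; apply: eq_big => [t|t st]; first by rewrite eq_sym.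
    by rewrite [ucenter B s t]ucenter_offdiag // -/(b s) -/(b t) -/SB -/al -/be; ring.
  under eq_bigr do rewrite big_split !sumrB /= -!mulr_sumr rA !mulr0 subr0 addr0.
  rewrite sumrB -mulr_sumr exchange_big /=.
  rewrite [X in _ - al * X]exchange_big /=.
  rewrite [X in _ - al * X]big1 ?mulr0 ?subr0; first by rewrite exchange_big.
  move=> t _; rewrite -mulr_suml (eq_bigr (ucenter A t)) ?rA ?mul0r // => s _.
  exact: ucenter_sym.
(* Then the remaining [ucenter A] is expanded; on the diagonal both sides vanish because [A] and [B]
   do. *)
transitivity (\sum_s \sum_t (A s t * B s t - al * a s * B s t
     - al * (a t * B s t) + be * SA * B s t)).
  apply: eq_bigr => s _; apply: eq_bigr => t _.
  case: (eqVneq s t) => [->|st]; first by rewrite ucenter_diag A0 B0; ring.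
  by rewrite ucenter_offdiag // -/(a s) -/(a t) -/SA -/al -/be; ring.
under eq_bigr do rewrite big_split !sumrB /= -!mulr_sumr -/(b _).
rewrite big_split !sumrB /= -!mulr_sumr -/SB -/SA.
have -> : \sum_i \sum_t a t * B i t = \sum_s a s * b s.
  rewrite exchange_big /=; apply: eq_bigr => s _; rewrite mulr_sumr.
  by apply: eq_bigr => t _; rewrite B_sym.
have -> : \sum_i al * a i * b i = al * \sum_i a i * b i.
  by rewrite mulr_sumr; apply: eq_bigr => s _; ring.
by ring.
Qed.

Definition sqdist_mx x : 'M[R]_n := \matrix_(s, t) (x s - x t) ^+ 2.

Lemma sqdist_mx_sym x s t : sqdist_mx x s t = sqdist_mx x t s.
Proof. by rewrite !mxE -sqrrN opprB. Qed.

Lemma sqdist_mx_diag x s : sqdist_mx x s s = 0.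
Proof. by rewrite mxE subrr expr0n. Qed.

(** The average over the permutations of increasing quadruples becomes one sum over quadruples of
    distinct indices, to which inclusion-exclusion applies. *)
Lemma cov2_distinct x y : cov2 x y =
  ('C(n, 4) * 4`!)%:R^-1 * 4^-1 *
  \sum_(s < n) \sum_(t < n | t != s) \sum_(u < n | (u != s) && (u != t))
    \sum_(v < n | [&& v != s, v != t & v != u])
      (x s - x t) * (y s - y t) * ((x u - x v) * (y u - y v)).
Proof.
pose F (q : 4.-tuple 'I_n) := let w (i : nat) := tnth q (inord i) in
  (x (w 0%N) - x (w 1%N)) * (y (w 0%N) - y (w 1%N))
  * ((x (w 2%N) - x (w 3%N)) * (y (w 2%N) - y (w 3%N))).
have FE s t u v : F [tuple s; t; u; v] =
    (x s - x t) * (y s - y t) * ((x u - x v) * (y u - y v)).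
  by rewrite /F !(tnth_nth s) !inordK.
under [X in _ = _ * X]eq_bigr do under eq_bigr do under eq_bigr do
  under eq_bigr do rewrite -FE.
rewrite -sum_increasing4 /cov2 natrM invfM -!mulrA; congr (_ * _).
rewrite !mulr_sumr; apply: eq_bigr => s _.
rewrite !mulr_sumr; apply: eq_bigr => t _.
rewrite !mulr_sumr; apply: eq_bigr => u _.
rewrite !mulr_sumr; apply: eq_bigr => v _.
rewrite !mulr_sumr; apply: eq_bigr => sigma _.
by rewrite /F !tnth_mktuple; ring.
Qed.

Lemma sum_sqr_diff x (x0 : \sum_s x s = 0) s :
  \sum_t (x s - x t) ^+ 2 = n%:R * x s ^+ 2 + \sum_t x t ^+ 2.
Proof.
transitivity (\sum_t (x s ^+ 2 + x t ^+ 2 - (2 * x s) * x t)).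
  by apply: eq_bigr => t _; ring.
by rewrite sumrB -mulr_sumr x0 mulr0 subr0 big_split /= sumr_const card_ord mulr_natl.
Qed.

Lemma sum_mul_diff x y (x0 : \sum_s x s = 0) (y0 : \sum_s y s = 0) s :
  \sum_t (x s - x t) * (y s - y t) = n%:R * (x s * y s) + \sum_t x t * y t.
Proof.
transitivity (\sum_t (x s * y s + x t * y t - x s * y t - y s * x t)).
  by apply: eq_bigr => t _; ring.
rewrite !sumrB -!mulr_sumr x0 y0 !mulr0 !subr0 big_split /= sumr_const card_ord.
by rewrite mulr_natl.
Qed.

(** After expansion, every term containing a lone factor [x] or [y] in one of the two indices sums
    to zero. *)
Lemma sum_sqr_mul_diff x y (x0 : \sum_s x s = 0) (y0 : \sum_s y s = 0) :
  \sum_s \sum_t ((x s - x t) * (y s - y t)) ^+ 2 =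
  2 * n%:R * (\sum_s x s ^+ 2 * y s ^+ 2) +
  2 * ((\sum_s x s ^+ 2) * (\sum_s y s ^+ 2)) + 4 * (\sum_s x s * y s) ^+ 2.
Proof.
(* [Q] is opaque so that factoring constants out of the inner sums does not split this product. *)
have [Q QE] : {Q | forall s, Q s = x s ^+ 2 * y s ^+ 2} by eexists.
transitivity (\sum_s \sum_t (Q s + Q t + (x s ^+ 2 * y t ^+ 2
   + (y s ^+ 2 * x t ^+ 2 + 4 * ((x s * y s) * (x t * y t))))
   - (2 * (x s ^+ 2 * y s * y t)) - 2 * (x s * y s ^+ 2 * x t)
   - (2 * (y s * (x t ^+ 2 * y t))) - 2 * (x s * (x t * y t ^+ 2)))).
  by apply: eq_bigr => s _; apply: eq_bigr => t _; rewrite !QE; ring.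
under eq_bigr do rewrite !sumrB !big_split /= -!mulr_sumr x0 y0 !mulr0 !subr0.
rewrite !sumrB !big_split /= -!mulr_sumr -!mulr_suml x0 y0 !mul0r !mulr0 !subr0.
have -> : \sum_i \sum_(j < n) Q i = n%:R * \sum_i Q i.
  by rewrite mulr_sumr; apply: eq_bigr => i _; rewrite sumr_const card_ord mulr_natl.
by rewrite sumr_const card_ord -[_ *+ n]mulr_natl (eq_bigr _ (fun s _ => QE s)); ring.
Qed.

(** For centered samples all sums on both sides reduce to the four moments [P], [Q], [Sx], [Sy], and
    the two sides are the same rational function of these and [n]. The bound on [n] keeps the
    denominators [n], [n-1], [n-2], [n-3] nonzero. *)
Lemma cov2_ucenter_centered x y (n_ge4 : (4 <= n)%N)
  (x0 : \sum_s x s = 0) (y0 : \sum_s y s = 0) :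
  cov2 x y = 4^-1 * udot (ucenter (sqdist_mx x)) (ucenter (sqdist_mx y)).
Proof.
have nk (i : nat) : (i < 4)%N -> n%:R - i%:R != 0 :> R.
  by move=> i4; rewrite subr_eq0 eqr_nat gtn_eqF // (leq_trans i4).
have := nk 0%N; have := nk 1%N; have := nk 2%N; have := nk 3%N.
move=> /(_ isT) n3 /(_ isT) n2 /(_ isT) n1 /(_ isT); rewrite subr0 => n0.
have binE : ('C(n, 4) * 4`!)%:R = n%:R * (n%:R - 1) * (n%:R - 2) * (n%:R - 3) :> R.
  rewrite bin_ffact !ffactnS ffactn0 muln1 -!subn1 -!subnDA !addn1 !natrM.
  by rewrite !natrB ?mulrA // (leq_trans _ n_ge4).
rewrite cov2_distinct binE udot_ucenter ?(ltnW n_ge4) //; last first.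
- exact: sqdist_mx_diag.
- exact: sqdist_mx_sym.
- exact: sqdist_mx_diag.
- exact: sqdist_mx_sym.
rewrite (sum_distinct4 (k := fun s t => (x s - x t) * (y s - y t))); first last.
- by move=> s t; ring.
- by move=> s; rewrite subrr mul0r.
pose P := \sum_s x s * y s; pose Q := \sum_s x s ^+ 2 * y s ^+ 2.
pose Sx := \sum_s x s ^+ 2; pose Sy := \sum_s y s ^+ 2.
have rx s : \sum_t sqdist_mx x s t = n%:R * x s ^+ 2 + Sx.
  by rewrite -sum_sqr_diff //; apply: eq_bigr => t _; rewrite mxE.
have ry s : \sum_t sqdist_mx y s t = n%:R * y s ^+ 2 + Sy.
  by rewrite -sum_sqr_diff //; apply: eq_bigr => t _; rewrite mxE.
have rk s : \sum_t (x s - x t) * (y s - y t) = n%:R * (x s * y s) + P.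
  exact: sum_mul_diff.
under [X in _ * (X ^+ 2 - _ + _)]eq_bigr do rewrite rk.
under [X in _ * (_ - 4 * X + _)]eq_bigr do rewrite rk.
under [X in _ = _ * (_ * (_ - _ * X + _))]eq_bigr do rewrite rx ry.
under [X in _ = _ * (_ * (_ + _ * (X * _)))]eq_bigr do rewrite rx.
under [X in _ = _ * (_ * (_ + _ * (_ * X)))]eq_bigr do rewrite ry.
have -> : \sum_s \sum_t sqdist_mx x s t * sqdist_mx y s t =
    \sum_s \sum_t ((x s - x t) * (y s - y t)) ^+ 2.
  by apply: eq_bigr => s _; apply: eq_bigr => t _; rewrite !mxE exprMn.
rewrite sum_sqr_mul_diff // -/P -/Q -/Sx -/Sy.
have cst c : \sum_(s < n) c = n%:R * c :> R by rewrite sumr_const card_ord mulr_natl.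
rewrite !big_split /= -!mulr_sumr !cst -/P -/Sx -/Sy.
have -> : \sum_i (n%:R * (x i * y i) + P) ^+ 2 = n%:R ^+ 2 * Q + 3 * n%:R * P ^+ 2.
  transitivity (\sum_i (n%:R ^+ 2 * (x i ^+ 2 * y i ^+ 2) +
      2 * n%:R * P * (x i * y i) + P ^+ 2)).
    by apply: eq_bigr => i _; ring.
  by rewrite !big_split /= -!mulr_sumr cst -/P -/Q; ring.
have -> : \sum_i (n%:R * x i ^+ 2 + Sx) * (n%:R * y i ^+ 2 + Sy) =
    n%:R ^+ 2 * Q + 3 * n%:R * (Sx * Sy).
  transitivity (\sum_i (n%:R ^+ 2 * (x i ^+ 2 * y i ^+ 2) +
      n%:R * Sy * x i ^+ 2 + n%:R * Sx * y i ^+ 2 + Sx * Sy)).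
    by apply: eq_bigr => i _; ring.
  by rewrite !big_split /= -!mulr_sumr cst -/Sx -/Sy -/Q; ring.
by field; rewrite n0 n1 n2 n3.
Qed.

(** Both sides depend on the samples only through differences, so the sample means may be
    subtracted. *)
Lemma cov2_ucenter x y (n_ge4 : (4 <= n)%N) :
  cov2 x y = 4^-1 * udot (ucenter (sqdist_mx x)) (ucenter (sqdist_mx y)).
Proof.
have n0 : n%:R != 0 :> R by rewrite pnatr_eq0 gtn_eqF // (leq_trans _ n_ge4).
pose center (z : 'I_n -> R) s := z s - n%:R^-1 * \sum_t z t.
have diffE z s t : center z s - center z t = z s - z t by rewrite /center; ring.
have center0 z : \sum_s center z s = 0.
  by rewrite sumrB sumr_const card_ord -[_ *+ n]mulr_natl mulVKf // subrr.
have sqE z : sqdist_mx (center z) = sqdist_mx z.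
  by apply/matrixP => s t; rewrite !mxE diffE.
rewrite -(sqE x) -(sqE y) -cov2_ucenter_centered //.
rewrite !cov2_distinct; congr (_ * _); do 4!apply: eq_bigr => ? _.
by rewrite !diffE.
Qed.

End CovarianceIdentity.

(** * The U-centered product as a bounded bilinear form *)

Section UCenteredProduct.
Variables (R : realType) (n : nat).
Implicit Types (A B C : 'M[R]_n).

Definition uprod A B : R := udot (ucenter A) (ucenter B).

Lemma ucenterD A B : ucenter (A + B) = ucenter A + ucenter B.
Proof.
apply/matrixP => s t; rewrite !mxE; case: eqP => _; first by rewrite addr0.
under eq_bigr do rewrite mxE; rewrite big_split /=.
under [\sum_u _ u t]eq_bigr do rewrite mxE; rewrite big_split /=.
under [\sum_u \sum_v _]eq_bigr do
  (under eq_bigr do rewrite mxE; rewrite big_split /=).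
rewrite big_split /=; ring.
Qed.

Lemma ucenterZ c A : ucenter (c *: A) = c *: ucenter A.
Proof.
apply/matrixP => s t; rewrite !mxE; case: eqP => _; first by rewrite mulr0.
under eq_bigr do rewrite mxE; rewrite -mulr_sumr.
under [\sum_u _ u t]eq_bigr do rewrite mxE; rewrite -mulr_sumr.
under [\sum_u \sum_v _]eq_bigr do
  (under eq_bigr do rewrite mxE; rewrite -mulr_sumr).
rewrite -mulr_sumr; ring.
Qed.

(** The row sums are [(n-1) c] and the total is [n (n-1) c], so an entry becomes
    [c - 2 (n-1)/(n-2) c + n/(n-2) c = 0]. This removes the zeroth-order term [f c] of the kernel
    expansion. *)
Lemma ucenter_offdiag_const (n_gt2 : (2 < n)%N) c :
  ucenter (\matrix_(s, t) if s == t then 0 else c) = 0 :> 'M[R]_n.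
Proof.
have n2 : n%:R - 2 != 0 :> R by rewrite subr_eq0 (eqr_nat R n 2) gtn_eqF.
have n1 : n%:R - 1 != 0 :> R by rewrite subr_eq0 (eqr_nat R n 1) gtn_eqF // ltnW.
have row (s : 'I_n) : \sum_v (\matrix_(s, t) if s == t then 0 else c) s v =
    (n%:R - 1) * c :> R.
  transitivity (\sum_(v < n) c - c); last first.
    by rewrite sumr_const card_ord -mulr_natl; ring.
  rewrite (bigD1 s) //= [X in _ = X - c](bigD1 s) //= mxE eqxx addrAC subrr.
  congr (_ + _); apply: eq_bigr => t; rewrite mxE eq_sym => /negPf ->; done.
apply/matrixP => s t; rewrite [RHS]mxE.
case: (eqVneq s t) => [->|st]; first exact: ucenter_diag.
rewrite ucenter_offdiag //; last by move=> i j; rewrite !mxE eq_sym.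
under [\sum_u _]eq_bigr do rewrite row.
rewrite !row mxE (negPf st) sumr_const card_ord -[_ *+ n]mulr_natl.
by field; rewrite n1 n2.
Qed.

Lemma uprodDl A B C : uprod (A + B) C = uprod A C + uprod B C.
Proof.
rewrite /uprod ucenterD /udot -mulrDr -big_split; congr (_ * _).
apply: eq_bigr => s _; rewrite -big_split; apply: eq_bigr => t _ /=.
by rewrite mxE mulrDl.
Qed.

Lemma uprodC A B : uprod A B = uprod B A.
Proof.
rewrite /uprod /udot; congr (_ * _); apply: eq_bigr => s _; apply: eq_bigr => t _.
exact: mulrC.
Qed.

Lemma uprodDr A B C : uprod A (B + C) = uprod A B + uprod A C.
Proof. by rewrite uprodC uprodDl !(uprodC A). Qed.

Lemma uprodZl c A B : uprod (c *: A) B = c * uprod A B.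
Proof.
rewrite /uprod ucenterZ /udot mulrCA; congr (_ * _); rewrite mulr_sumr.
apply: eq_bigr => s _; rewrite mulr_sumr; apply: eq_bigr => t _.
by rewrite mxE mulrA.
Qed.

Lemma uprodZr c A B : uprod A (c *: B) = c * uprod A B.
Proof. by rewrite uprodC uprodZl uprodC. Qed.

Lemma uprod_suml (I : finType) (F : I -> 'M[R]_n) B :
  uprod (\sum_i F i) B = \sum_i uprod (F i) B.
Proof.
apply: (big_morph (uprod^~ B)) => [A C|]; first exact: uprodDl.
by rewrite -(scale0r 0) uprodZl mul0r.
Qed.

Lemma uprod_sumr (I : finType) (F : I -> 'M[R]_n) B :
  uprod B (\sum_i F i) = \sum_i uprod B (F i).
Proof. by rewrite uprodC uprod_suml; apply: eq_bigr => i _; rewrite uprodC. Qed.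

Lemma uprod_offdiag_constl (n_gt2 : (2 < n)%N) c B :
  uprod (\matrix_(s, t) if s == t then 0 else c) B = 0.
Proof.
rewrite /uprod ucenter_offdiag_const // /udot big1 ?mulr0 // => s _.
by rewrite big1 // => t _; rewrite mxE mul0r.
Qed.

Lemma uprod_offdiag_constr (n_gt2 : (2 < n)%N) c B :
  uprod B (\matrix_(s, t) if s == t then 0 else c) = 0.
Proof. by rewrite uprodC uprod_offdiag_constl. Qed.

Lemma ler_norm_sum_const (F : 'I_n -> R) a :
  (forall i, `|F i| <= a) -> `|\sum_i F i| <= n%:R * a.
Proof.
move=> Fa; apply: le_trans (ler_norm_sum _ _ _) _.
by rewrite mulr_natl -[X in a *+ X]card_ord -sumr_const; apply: ler_sum.
Qed.

(** The constant depends on [n] alone, which makes all later bounds uniform in [p] and [q]. *)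
Lemma norm_ucenter_le : exists2 K : R, 0 <= K & forall A a,
  (forall s t, `|A s t| <= a) -> forall s t, `|ucenter A s t| <= K * a.
Proof.
pose u : R := `|n%:R - 2|^-1; pose v : R := `|(n%:R - 1) * (n%:R - 2)|^-1.
exists (1 + u * n%:R + u * n%:R + v * (n%:R * n%:R)).
  by rewrite !addr_ge0 ?mulr_ge0 ?invr_ge0.
move=> A a Aa s t; have a0 : 0 <= a := le_trans (normr_ge0 _) (Aa s t).
rewrite mxE; case: eqP => _.
  by rewrite normr0 mulr_ge0 // !addr_ge0 ?mulr_ge0 ?invr_ge0.
rewrite (_ : _ * a = a + u * n%:R * a + u * n%:R * a + v * (n%:R * n%:R) * a); last ring.
apply: le_trans (ler_normD _ _) _; apply: lerD.
  apply: le_trans (ler_normB _ _) _; apply: lerD.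
    apply: le_trans (ler_normB _ _) _; apply: lerD => //.
    rewrite normrM normfV -mulrA ler_wpM2l ?invr_ge0 //.
    exact: ler_norm_sum_const.
  rewrite normrM normfV -mulrA ler_wpM2l ?invr_ge0 //.
  exact: ler_norm_sum_const.
rewrite normrM normfV -!mulrA ler_wpM2l ?invr_ge0 //.
apply: ler_norm_sum_const => i; exact: ler_norm_sum_const.
Qed.

Lemma norm_uprod_le : exists2 K : R, 0 <= K & forall A B a b,
  0 <= a -> 0 <= b ->
  (forall s t, `|A s t| <= a) -> (forall s t, `|B s t| <= b) ->
  `|uprod A B| <= K * (a * b).
Proof.
have [K K0 KP] := norm_ucenter_le.
pose u : R := `|n%:R * (n%:R - 3)|^-1.
exists (u * (n%:R * (n%:R * (K * K)))); first by rewrite !mulr_ge0 ?invr_ge0.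
move=> A B a b a0 b0 Aa Bb; rewrite /uprod /udot normrM normfV -!mulrA.
rewrite ler_wpM2l ?invr_ge0 //.
apply: ler_norm_sum_const => s; rewrite big_mkcond.
apply: ler_norm_sum_const => t; rewrite mulrA mulrACA.
case: ifP => _; last by rewrite normr0 !mulr_ge0.
by rewrite normrM; apply: ler_pM => //; exact: KP.
Qed.

End UCenteredProduct.

(** * Deterministic expansion *)

Section Bandwidth.
Variables (R : realType).

(** Both middle order statistics are entries of [s]: nonemptiness keeps their indices in range, away
    from the default value 0. *)
Lemma median_itv (s : seq R) (lo hi : R) : s != [::] ->
  (forall d, d \in s -> lo <= d <= hi) -> lo <= median s <= hi.
Proof.
move=> s0 sP; have t0 : (0 < size (sort <=%R s))%N.
  by rewrite size_sort; case: s s0 {sP}.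
have nthP (i : nat) : (i < size (sort <=%R s))%N -> lo <= (sort <=%R s)`_i <= hi.
  by move=> il; apply: sP; rewrite -(mem_sort <=%R) mem_nth.
rewrite /median; set t := sort _ _ in t0 nthP *.
have h1 := nthP (size t).-1./2; have h2 := nthP (size t)./2.
have {h1} /andP[] : lo <= t`_((size t).-1./2) <= hi.
  apply: h1; rewrite (leq_ltn_trans (half_leq (leq_pred _))) //.
  by rewrite ltn_half_double -addnn -[X in (X < _)%N]addn0 ltn_add2l.
have {h2} /andP[] : lo <= t`_((size t)./2) <= hi.
  by apply: h2; rewrite ltn_half_double -addnn -[X in (X < _)%N]addn0 ltn_add2l.
lra.
Qed.

Lemma bandwidth_itv (n p : nat) (x : 'I_n -> p.-tuple R) (lo hi : R) :
  (1 < n)%N -> (forall s t, s != t -> lo <= Defs.edist (x s) (x t) <= hi) ->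
  lo <= bandwidth x <= hi.
Proof.
move=> n1 xP; apply: median_itv.
  (* The first two indices provide a pair, so the list of distances is nonempty. *)
  have st : Ordinal (ltnW n1) != Ordinal n1 by [].
  apply/negP => /eqP; move/(congr1 (fun s =>
    Defs.edist (x (Ordinal (ltnW n1))) (x (Ordinal n1)) \in s)).
  rewrite in_nil => /negP; apply; apply/mapP.
  by exists (Ordinal (ltnW n1), Ordinal n1) => //; rewrite mem_filter st mem_enum.
by move=> d /mapP[[s t]]; rewrite mem_filter => /andP[/= st _] ->; exact: xP.
Qed.

(* The off-diagonal entries are [L_X (X_s, X_t)] when [tau] is [tauX]. *)
Definition relvar (n p : nat) (tau : R) (x : 'I_n -> p.-tuple R) : 'M[R]_n :=
  \matrix_(s, t)
    if s == t then 0 else (Defs.edist (x s) (x t) ^+ 2 - tau ^+ 2) / tau ^+ 2.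

Lemma edist_ge0 (p : nat) (x y : p.-tuple R) : 0 <= Defs.edist x y.
Proof. exact: sqrtr_ge0. Qed.

(** With [r] the ratio, the entry of [relvar] is [(r - 1) (r + 1)], and [r + 1 >= 1]. *)
Lemma edist_ratio (n p : nat) (tau : R) (x : 'I_n -> p.-tuple R) (d : R) s t :
  0 < tau -> `|relvar tau x s t| <= d -> s != t ->
  `|Defs.edist (x s) (x t) / tau - 1| <= d.
Proof.
move=> tau0 + st; rewrite mxE (negPf st); set e := Defs.edist _ _; set r := e / tau.
have -> : (e ^+ 2 - tau ^+ 2) / tau ^+ 2 = (r - 1) * (r + 1).
  by rewrite /r; field; rewrite gt_eqF.
have r0 : 0 <= r by rewrite divr_ge0 ?edist_ge0 // ltW.
apply: le_trans; rewrite normrM ler_peMr // ger0_norm; lra.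
Qed.

(** The median lies in [[tau (1 - d), tau (1 + d)]] with all the distances, and
    [1 / (1 - d) <= 1 + 2 d] for [d <= 1/2]. *)
Lemma bandwidth_ratio (n p : nat) (tau : R) (x : 'I_n -> p.-tuple R) (d : R) :
  (1 < n)%N -> 0 < tau -> d <= 2^-1 ->
  (forall s t, `|relvar tau x s t| <= d) ->
  `|tau / bandwidth x - 1| <= 2 * d /\ 0 < bandwidth x.
Proof.
move=> n1 tau0 d2 xP.
have d0 : 0 <= d by apply: le_trans (xP (Ordinal n1) (Ordinal n1)).
have /andP[lo hi] : tau * (1 - d) <= bandwidth x <= tau * (1 + d).
  apply: bandwidth_itv => // s t st.
  have := edist_ratio tau0 (xP s t) st; rewrite ler_norml lerBrDr lerBlDr.
  rewrite ler_pdivlMr // ler_pdivrMr // => /andP[h1 h2]; apply/andP; split; lra.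
have b0 : 0 < bandwidth x by apply: lt_le_trans lo; rewrite mulr_gt0 //; lra.
split => //; rewrite ler_norml lerBrDr lerBlDr ler_pdivlMr // ler_pdivrMr //.
apply/andP; split; nra.
Qed.

End Bandwidth.

(** * First-order expansion of a radial kernel *)

Section KernelExpansion.
Variables (R : realType).

(** The intermediate point lies between [u] and [v], in whichever order they come, hence as close to
    1 as they are. *)
Lemma mean_value_near1 (f : R -> R) (e u v : R) :
  (forall x, derivable f x 1) -> `|u - 1| <= e -> `|v - 1| <= e ->
  exists2 z, `|z - 1| <= e & f v - f u = derive1 f z * (v - u).
Proof.
move=> df; wlog uv : u v / u <= v => [H ue ve|].
  have [/H|/ltW vu] := leP u v; first by apply.
  have [z ze fz] := H v u vu ve ue.
  by exists z => //; rewrite -opprB fz -mulrN opprB.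
have fc : {within `[u, v], continuous f}.
  by apply: derivable_within_continuous => x _; exact: df.
have f' (x : R) : x \in `]u, v[ -> is_derive x 1 f (derive1 f x).
  by rewrite derive1E => _; apply: DeriveDef.
move=> ue ve; have [z zuv ->] := MVT_segment uv f' fc.
exists z => //; move: zuv ue ve; rewrite in_itv /= !ler_distl.
move=> /andP[? ?] /andP[? ?] /andP[? ?]; apply/andP; split; lra.
Qed.

(** The mean value theorem gives [f' z * c * (r - 1)] with [z] within [4 d] of 1. Replacing [f' z]
    by [f' c] costs [O(d)], as both are compared with [f' 1], and the factor [r - 1] makes the error
    quadratic. *)
Lemma kernel_expansion (f : R -> R) :
  (forall x, derivable f x 1) -> deriv_lipschitz_at1 f ->
  exists K e : R, [/\ 0 <= K, 0 < e & forall d c r : R,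
    d <= e -> `|c - 1| <= 2 * d -> `|r - 1| <= d ->
    `|f (c * r) - f c - (c * derive1 f c / 2) * (r ^+ 2 - 1)| <= K * d ^+ 2 /\
    `|c * derive1 f c / 2| <= K].
Proof.
move=> df [C /nbhs_ballP[e0 /= e00 Ce]].
pose C1 := `|C|; pose D := `|derive1 f 1|.
have lip z : `|z - 1| < e0 -> `|derive1 f z - derive1 f 1| <= C1 * `|z - 1|.
  move=> ze; apply: le_trans (Ce z _) _; first by rewrite /ball /= distrC.
  by rewrite ler_wpM2r // ler_norm.
(* [d <= 1/4] gives [|c| <= 2], and [d <= e0 / 8] keeps points within [4 d] of 1 inside the
   Lipschitz neighbourhood. The errors below add up to [(17 C1 + D) d^2], and the coefficient is at
   most [C1 + D]. *)
exists (20 * C1 + 2 * D), (Num.min 4^-1 (e0 / 8)); split.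
- by rewrite addr_ge0 // mulr_ge0 // normr_ge0.
- by rewrite lt_min invr_gt0 ltr0n divr_gt0.
move=> d c r; rewrite le_min => /andP[d4 de] cd rd.
have d0 : 0 <= d := le_trans (normr_ge0 _) rd.
have C10 : 0 <= C1 := normr_ge0 _; have D0 : 0 <= D := normr_ge0 _.
have c2 : `|c| <= 2.
  by rewrite -[c](subrK 1); apply: le_trans (ler_normD _ _) _; rewrite normr1; lra.
have crd : `|c * r - 1| <= 4 * d.
  have -> : c * r - 1 = c * (r - 1) + (c - 1) by ring.
  apply: le_trans (ler_normD _ _) _; rewrite normrM.
  have : `|c| * `|r - 1| <= 2 * d by apply: ler_pM.
  lra.
have c4d : `|c - 1| <= 4 * d by lra.
have [z zd ->] := mean_value_near1 df c4d crd.
have fz : `|derive1 f z - derive1 f 1| <= C1 * (4 * d).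
  by apply: le_trans (lip _ _) _; [lra|rewrite ler_wpM2l].
have fc : `|derive1 f c - derive1 f 1| <= C1 * (4 * d).
  by apply: le_trans (lip _ _) _; [lra|rewrite ler_wpM2l].
have fzc : `|derive1 f z - derive1 f c| <= 8 * C1 * d.
  apply: le_trans (ler_distD (derive1 f 1) _ _) _.
  rewrite (distrC (derive1 f 1)); lra.
have fc1 : `|derive1 f c| <= C1 + D.
  rewrite -[derive1 f c](subrK (derive1 f 1)); apply: le_trans (ler_normD _ _) _.
  rewrite -/D lerD2r; apply: le_trans fc _; rewrite ler_piMr //; lra.
have cf : `|c| * `|derive1 f c| <= 2 * (C1 + D) by apply: ler_pM.
split; last first.
  rewrite normrM normrM [`|2^-1|]ger0_norm // ler_pdivrMr //; lra.
(* [r - 1 = (r ^+ 2 - 1) / 2 - (r - 1) ^+ 2 / 2] *)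
have -> : derive1 f z * (c * r - c) - c * derive1 f c / 2 * (r ^+ 2 - 1) =
  c * (derive1 f z - derive1 f c) * (r - 1) - c * derive1 f c * (r - 1) ^+ 2 / 2.
  by field.
apply: le_trans (ler_normB _ _) _.
have h1 : `|c * (derive1 f z - derive1 f c) * (r - 1)| <= 2 * (8 * C1 * d) * d.
  by rewrite !normrM; do 2!apply: ler_pM => //; rewrite mulr_ge0.
have h2 : `|c * derive1 f c * (r - 1) ^+ 2 / 2| <= (2 * (C1 + D)) * d ^+ 2 / 2.
  rewrite normrM [`|2^-1|]ger0_norm // ler_wpM2r // normrM normrX normrM.
  by apply: ler_pM; rewrite ?mulr_ge0 ?exprn_ge0 ?lerXn2r ?nnegrE.
apply: le_trans (lerD h1 h2) _.
have : 0 <= C1 * d ^+ 2 by rewrite mulr_ge0 ?exprn_ge0.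
have : 0 <= D * d ^+ 2 by rewrite mulr_ge0 ?exprn_ge0.
lra.
Qed.

(** [f' c * c] is continuous in [c] with the nonzero value [f' 1] at 1, so near 1 it differs from it
    by at most half its size. *)
Lemma derivative_factor_near (f : R -> R) : continuous (derive1 f) ->
  derive1 f 1 != 0 -> exists2 e : R, 0 < e & forall c, `|c - 1| <= e ->
    `|derive1 f 1| / 2 <= `|derive1 f c * c| <= 2 * `|derive1 f 1|.
Proof.
move=> cf f1.
have : (fun c => derive1 f c * c) @ (1 : R) --> derive1 f 1 * 1.
  by apply: cvgM; [exact: cf|exact: cvg_id].
rewrite mulr1 => /cvgrPdist_le /(_ (`|derive1 f 1| / 2)).
rewrite divr_gt0 ?normr_gt0 // => /(_ isT) /nbhs_ballP[e /= e0 He].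
exists (e / 2); first by rewrite divr_gt0.
move=> c ce; have := He c; rewrite /ball /= distrC => /(_ _)/wrap[].
  by apply: le_lt_trans ce _; rewrite ltr_pdivrMr // ltr_pMr // ltr1n.
set u := derive1 f 1; set v := derive1 f c * c => uv.
have := ler_dist_dist u v; rewrite ler_norml => /andP[h1 h2].
have := le_trans (ler_dist_dist u v) uv; rewrite ler_norml => /andP[h3 h4].
by apply/andP; split; have := normr_ge0 u; lra.
Qed.

End KernelExpansion.

(** * Expansion of the kernel matrices and deterministic bound of the remainder *)

Section RemainderBound.
Variables (R : realType) (n : nat) (n_ge4 : (4 <= n)%N).

(** Entrywise [kernel_expansion]: with [r] the distance divided by [tau], the kernel argument is
    [c * r] and [r ^+ 2 - 1] is the entry of [relvar]. *)
Lemma kernel_mx_expansion (f : R -> R) :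
  (forall x, derivable f x 1) -> deriv_lipschitz_at1 f ->
  exists K e : R, [/\ 0 <= K, 0 < e & forall p (x : 'I_n -> p.-tuple R) (tau d : R),
    0 < tau -> d <= e -> (forall s t, `|relvar tau x s t| <= d) ->
    let c := tau / bandwidth x in
    `|c * derive1 f c / 2| <= K /\
    exists2 E : 'M[R]_n, (forall s t, `|E s t| <= K * d ^+ 2) &
    kernel_mx f x = (\matrix_(s, t) if s == t then 0 else f c)
      + ((c * derive1 f c / 2) *: relvar tau x + E)].
Proof.
move=> df lf; have [K [e [K0 e0 Ke]]] := kernel_expansion df lf.
have n1 : (1 < n)%N by rewrite (leq_trans _ n_ge4).
exists K, (Num.min e 2^-1); split => //; first by rewrite lt_min e0 invr_gt0 ltr0n.
move=> p x tau d tau0; rewrite le_min => /andP[de d2] xd c.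
have [cd b0] := bandwidth_ratio n1 tau0 d2 xd.
have d0 : 0 <= d by apply: le_trans (xd (Ordinal n1) (Ordinal n1)).
(* The bound on the coefficient does not involve [r], so the expansion is invoked at [r = 1]. *)
split; first by apply: (Ke d c 1 de cd _).2; rewrite subrr normr0.
(* [E] is what the expansion leaves over, so the identity is immediate and only the bound has
   content. *)
exists (\matrix_(s, t) if s == t then 0 else
   f (Defs.edist (x s) (x t) / bandwidth x) - f c
   - (c * derive1 f c / 2) * relvar tau x s t); last first.
  by apply/matrixP => s t; rewrite !mxE; case: eqP => _; ring.
move=> s t; rewrite mxE; case: (eqVneq s t) => [_|st].
  by rewrite normr0 mulr_ge0 ?exprn_ge0.
have rd := edist_ratio tau0 (xd s t) st.
have [+ _] := Ke d c _ de cd rd; congr (`| f _ - _ - _ * _ | <= _).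
  by rewrite /c; field; rewrite !gt_eqF.
by rewrite mxE (negPf st); field; rewrite gt_eqF.
Qed.

(** Summed over the coordinates, the squared differences give the squared distance, which is
    [tau ^+ 2] times one plus the relative deviation off the diagonal. *)
Lemma sum_sqdist_mx p (x : 'I_n -> p.-tuple R) (tau : R) : 0 < tau ->
  \sum_(i < p) sqdist_mx (fun s => tnth (x s) i) =
  tau ^+ 2 *: (relvar tau x + \matrix_(s, t) if s == t then 0 else 1).
Proof.
move=> tau0; apply/matrixP => s t; rewrite summxE !mxE.
under eq_bigr do rewrite mxE; case: (eqVneq s t) => [->|st].
  by rewrite addr0 mulr0 big1 // => i _; rewrite subrr expr0n.
rewrite /Defs.edist sqr_sqrtr ?sumr_ge0 // => [|i _]; last exact: sqr_ge0.
by field; rewrite gt_eqF.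
Qed.

(** By bilinearity the double sum moves inside the product; the off-diagonal constants vanish, and
    [tx ^+ 2 * ty ^+ 2] against the inverse of [tx * ty] leaves [tx * ty]. *)
Lemma sum_cov2 p q (x : 'I_n -> p.-tuple R) (y : 'I_n -> q.-tuple R) (tx ty : R) :
  0 < tx -> 0 < ty ->
  (tx * ty)^-1 * \sum_(i < p) \sum_(j < q)
    cov2 (fun s => tnth (x s) i) (fun s => tnth (y s) j) =
  tx * ty / 4 * uprod (relvar tx x) (relvar ty y).
Proof.
move=> tx0 ty0; have n2 : (2 < n)%N := ltnW n_ge4.
transitivity ((tx * ty)^-1 * (4^-1 *
  uprod (\sum_(i < p) sqdist_mx (fun s => tnth (x s) i))
        (\sum_(j < q) sqdist_mx (fun s => tnth (y s) j)))).
  congr (_ * _); rewrite uprod_suml mulr_sumr; apply: eq_bigr => i _.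
  rewrite uprod_sumr mulr_sumr; apply: eq_bigr => j _.
  exact: cov2_ucenter.
rewrite (sum_sqdist_mx _ tx0) (sum_sqdist_mx _ ty0) uprodZl uprodZr.
rewrite uprodDl uprodDr !uprod_offdiag_constl // uprod_offdiag_constr //.
by field; rewrite !gt_eqF.
Qed.

Lemma norm_sum_cov2_le : exists2 K : R, 0 <= K &
  forall p q (x : 'I_n -> p.-tuple R) (y : 'I_n -> q.-tuple R) (tx ty dx dy : R),
  0 < tx -> 0 < ty ->
  (forall s t, `|relvar tx x s t| <= dx) -> (forall s t, `|relvar ty y s t| <= dy) ->
  `|(tx * ty)^-1 * \sum_(i < p) \sum_(j < q)
    cov2 (fun s => tnth (x s) i) (fun s => tnth (y s) j)| <=
  K * (tx * ty * dx * dy).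
Proof.
have [K K0 KP] := norm_uprod_le R n; exists (K / 4); first by rewrite divr_ge0.
move=> p q x y tx ty dx dy tx0 ty0 xd yd; rewrite sum_cov2 //.
have n1 : (1 < n)%N by rewrite (leq_trans _ n_ge4).
have dx0 : 0 <= dx by apply: le_trans (xd (Ordinal n1) (Ordinal n1)).
have dy0 : 0 <= dy by apply: le_trans (yd (Ordinal n1) (Ordinal n1)).
rewrite normrM ger0_norm; last by rewrite divr_ge0 // mulr_ge0 ?ltW.
rewrite [leRHS](_ : _ = tx * ty / 4 * (K * (dx * dy))); last by ring.
by rewrite ler_wpM2l ?KP // divr_ge0 // mulr_ge0 ?ltW.
Qed.

(** In the product of the two expansions the constants vanish and the bilinear term in the
    deviations is exactly the leading term. There remain [L_X] with [F], [E] with [L_Y] and [E] with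
    [F], of orders [dx dy^2], [dx^2 dy] and [dx^2 dy^2]. *)
Lemma norm_remainder_le (f g : R -> R) :
  (forall x, derivable f x 1) -> deriv_lipschitz_at1 f ->
  (forall x, derivable g x 1) -> deriv_lipschitz_at1 g ->
  exists K e : R, [/\ 0 <= K, 0 < e &
  forall p q (x : 'I_n -> p.-tuple R) (y : 'I_n -> q.-tuple R) (tx ty dx dy : R),
  0 < tx -> 0 < ty -> dx <= e -> dy <= e ->
  (forall s t, `|relvar tx x s t| <= dx) -> (forall s t, `|relvar ty y s t| <= dy) ->
  `|tx * ty * hcov2 f g x y -
    derive1 f (tx / bandwidth x) * derive1 g (ty / bandwidth y)
    * (tx / bandwidth x) * (ty / bandwidth y) *
    ((tx * ty)^-1 * \sum_(i < p) \sum_(j < q)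
      cov2 (fun s => tnth (x s) i) (fun s => tnth (y s) j))| <=
  K * (tx * ty * dx ^+ 2 * dy + tx * ty * dx * dy ^+ 2)].
Proof.
move=> df lf dg lg.
have [K K0 KP] := norm_uprod_le R n.
have [Kf [ef [Kf0 ef0 KfP]]] := kernel_mx_expansion df lf.
have [Kg [eg [Kg0 eg0 KgP]]] := kernel_mx_expansion dg lg.
(* The cap 1 lets [dx^2 dy^2] be absorbed into [dx^2 dy], whence the factor 2. *)
exists (K * (Kf * Kg) * 2), (Num.min 1 (Num.min ef eg)); split.
- by rewrite !mulr_ge0.
- by rewrite !lt_min ltr01 ef0.
move=> p q x y tx ty dx dy tx0 ty0.
rewrite le_min le_min => /and3P[dx1 dxf _].
rewrite le_min le_min => /and3P[dy1 _ dyg] xd yd.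
set cx := tx / _; set cy := ty / _.
have n1 : (1 < n)%N by rewrite (leq_trans _ n_ge4).
have n2 : (2 < n)%N := ltnW n_ge4.
have dx0 : 0 <= dx by apply: le_trans (xd (Ordinal n1) (Ordinal n1)).
have dy0 : 0 <= dy by apply: le_trans (yd (Ordinal n1) (Ordinal n1)).
have [kx [E ED fE]] := KfP p x tx dx tx0 dxf xd.
have [ky [F FD gF]] := KgP q y ty dy ty0 dyg yd.
rewrite -/cx -/cy in kx ky fE gF.
rewrite sum_cov2 // /hcov2 -/(uprod _ _) fE gF.
rewrite uprodDl uprod_offdiag_constl // add0r uprodDr uprod_offdiag_constr // add0r.
set LX := relvar tx x; set LY := relvar ty y.
set kX := cx * _ / 2 in kx *; set kY := cy * _ / 2 in ky *.
rewrite uprodDl !uprodDr !uprodZl !uprodZr.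
(* [kX * kY] is a quarter of the derivative factor, matching the quarter in [sum_cov2], so the main
   terms cancel. *)
rewrite [X in `|X|](_ : _ = tx * ty * (kX * uprod LX F + kY * uprod E LY
  + uprod E F)); last by rewrite /kX /kY; field.
have txy : 0 <= tx * ty by rewrite mulr_ge0 ?ltW.
rewrite normrM ger0_norm //.
rewrite [leRHS](_ : _ = tx * ty *
  (K * (Kf * Kg) * 2 * (dx ^+ 2 * dy + dx * dy ^+ 2))); last ring.
rewrite ler_wpM2l //.
have bF : `|uprod LX F| <= K * (dx * (Kg * dy ^+ 2)).
  by apply: KP => //; rewrite mulr_ge0 ?exprn_ge0.
have bE : `|uprod E LY| <= K * (Kf * dx ^+ 2 * dy).
  by apply: KP => //; rewrite mulr_ge0 ?exprn_ge0.
have bEF : `|uprod E F| <= K * (Kf * dx ^+ 2 * (Kg * dy ^+ 2)).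
  by apply: KP => //; rewrite mulr_ge0 ?exprn_ge0.
have h1 : `|kX * uprod LX F| <= Kf * (K * (dx * (Kg * dy ^+ 2))).
  by rewrite normrM; apply: ler_pM.
have h2 : `|kY * uprod E LY| <= Kg * (K * (Kf * dx ^+ 2 * dy)).
  by rewrite normrM; apply: ler_pM.
have dd : dx ^+ 2 * dy ^+ 2 <= dx ^+ 2 * dy.
  by rewrite ler_wpM2l ?exprn_ge0 // expr2 ler_piMr.
have h3 : K * (Kf * dx ^+ 2 * (Kg * dy ^+ 2)) <= K * (Kf * Kg) * (dx ^+ 2 * dy).
  rewrite (_ : K * _ = K * (Kf * Kg) * (dx ^+ 2 * dy ^+ 2)); last ring.
  by rewrite ler_wpM2l // !mulr_ge0.
have h4 : 0 <= K * (Kf * Kg) * (dx * dy ^+ 2).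
  by rewrite !mulr_ge0 ?exprn_ge0.
apply: le_trans (ler_normD _ _) _.
have := ler_normD (kX * uprod LX F) (kY * uprod E LY).
lra.
Qed.

End RemainderBound.

(** * Measurability *)

(* A probability has junk values on non-measurable sets, so comparing events
   requires the statistics, and in particular the median, to be measurable. *)
Section Measurability.
Context {d : measure_display} {T : measurableType d} {R : realType}.
Implicit Types (h : T -> R).

(** The inverse is written as [h] times the inverse of [h^2], a measurable power of a nonnegative
    function; at [h = 0] both sides are 0. *)
Lemma measurable_funV h : measurable_fun setT h -> measurable_fun setT (fun w => (h w)^-1).
Proof.
move=> mh; rewrite (_ : (fun w => _) = fun w => h w * powR (h w ^+ 2) (-1)).
  apply: measurable_funM => //.
  exact: (measurableT_comp (measurable_powR (-1)) (measurable_funX 2 mh)).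
apply/funext => w; rewrite powR_inv1 ?sqr_ge0 //.
have [->|h0] := eqVneq (h w) 0; first by rewrite invr0 mul0r.
by rewrite expr2 invfM mulrA divff // mul1r.
Qed.

Lemma measurable_ltr_set (h1 h2 : T -> R) :
  measurable_fun setT h1 -> measurable_fun setT h2 ->
  measurable [set w | h1 w < h2 w].
Proof.
move=> m1 m2; have := measurable_fun_ltr m1 m2 measurableT (Y := [set true]).
by rewrite setTI; apply.
Qed.

Lemma measurable_fun_sqrt h : measurable_fun setT h ->
  measurable_fun setT (fun w => Num.sqrt (h w)).
Proof.
by apply: measurableT_comp; apply: continuous_measurable_fun; exact: sqrt_continuous.
Qed.

Lemma measurable_fun_count (I : Type) (L : seq I) (D : I -> T -> R) c :
  (forall i, measurable_fun setT (D i)) ->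
  measurable_fun setT (fun w => count (fun x : R => x <= c) [seq D i w | i <- L]).
Proof.
move=> mD; elim: L => [|i L IH] /=; first exact: measurable_cst.
apply: measurable_fun_addn IH.
rewrite (_ : (fun _ => _) = fun w => if D i w <= c then 1%N else 0%N); last first.
  by apply/funext => w; case: (_ <= _).
apply: measurable_fun_ifT; try exact: measurable_cst.
by apply: measurable_fun_ler => //; exact: measurable_cst.
Qed.

(** Counting from 0, the [k]-th order statistic exceeds [c] exactly when at most [k] entries are
    [<= c], and open rays generate the Borel sets. *)
Lemma measurable_fun_nth_sort (I : Type) (L : seq I) (D : I -> T -> R) (k : nat) :
  (forall i, measurable_fun setT (D i)) ->
  measurable_fun setT (fun w => (sort <=%R [seq D i w | i <- L])`_k).
Proof.
move=> mD; have [Lk|kL] := leqP (size L) k.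
  (* Beyond the end of the list the value is the default 0. *)
  rewrite (_ : (fun _ => _) = cst 0); first exact: measurable_cst.
  by apply/funext => w; rewrite nth_default // size_sort size_map.
move=> mT; apply: (measurability _ (RGenOInfty.measurableE R)) => //.
move=> /= _ [_ [c ->] <-].
pose cnt w := count (fun x : R => x <= c) [seq D i w | i <- L].
rewrite (_ : _ `&` _ = setT `&` (fun w => (cnt w <= k)%N) @^-1` [set true]).
  have: measurable_fun setT (fun w => (cnt w <= k)%N).
    by apply: measurable_fun_leq; [exact: measurable_fun_count|exact: measurable_cst].
  by apply.
congr (_ `&` _); apply/seteqP; split => w /=; rewrite in_itv /= andbT;
    rewrite /cnt -(count_sort <=%R (fun x : R => x <= c) [seq D i w | i <- L]);
    set s := sort _ _; have ss : sorted <=%O s by exact: sort_le_sorted.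
  by move=> cs; rewrite leqNgt; apply/negP => /(nth_count_le 0 ss); rewrite leNgt cs.
by move=> cs; apply: nth_count_gt => //; rewrite cs size_sort size_map.
Qed.

Lemma measurable_fun_median (I : Type) (L : seq I) (D : I -> T -> R) :
  (forall i, measurable_fun setT (D i)) ->
  measurable_fun setT (fun w => median [seq D i w | i <- L]).
Proof.
move=> mD; rewrite /median; apply: measurable_funM; last exact: measurable_cst.
under eq_fun do rewrite size_sort size_map.
by apply: measurable_funD; exact: measurable_fun_nth_sort.
Qed.

Lemma measurable_fun_edist (p : nat) (x y : T -> p.-tuple R) :
  measurable_fun setT x -> measurable_fun setT y ->
  measurable_fun setT (fun w => Defs.edist (x w) (y w)).
Proof.
move=> mx my; apply: measurable_fun_sqrt; apply: measurable_sum => i.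
apply: measurable_funX; apply: measurable_funB.
  exact: (measurableT_comp (measurable_tnth i) mx).
exact: (measurableT_comp (measurable_tnth i) my).
Qed.

Variables (n : nat).

Lemma measurable_fun_bandwidth (p : nat) (x : T -> 'I_n -> p.-tuple R) :
  (forall s, measurable_fun setT (x^~ s)) ->
  measurable_fun setT (fun w => bandwidth (x w)).
Proof.
move=> mx; apply: measurable_fun_median => st; exact: measurable_fun_edist.
Qed.

Lemma measurable_fun_ucenter (A : T -> 'M[R]_n) :
  (forall s t, measurable_fun setT (fun w => A w s t)) ->
  forall s t, measurable_fun setT (fun w => ucenter (A w) s t).
Proof.
move=> mA s t; under eq_fun do rewrite mxE.
case: (s == t); first exact: measurable_cst.
apply: measurable_funD; [apply: measurable_funB; [apply: measurable_funB|]|] => //.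
- by apply: measurable_funM; [exact: measurable_cst|apply: measurable_sum].
- by apply: measurable_funM; [exact: measurable_cst|apply: measurable_sum].
- apply: measurable_funM; [exact: measurable_cst|apply: measurable_sum => i].
  by apply: measurable_sum.
Qed.

Lemma measurable_fun_kernel_mx (f : R -> R) (p : nat) (x : T -> 'I_n -> p.-tuple R) :
  measurable_fun setT f -> (forall s, measurable_fun setT (x^~ s)) ->
  forall s t, measurable_fun setT (fun w => kernel_mx f (x w) s t).
Proof.
move=> mf mx s t; under eq_fun do rewrite mxE.
case: (s == t); first exact: measurable_cst.
apply: measurableT_comp => //; apply: measurable_funM; first exact: measurable_fun_edist.
by apply: measurable_funV; exact: measurable_fun_bandwidth.
Qed.

Lemma measurable_fun_hcov2 (f g : R -> R) (p q : nat)
    (x : T -> 'I_n -> p.-tuple R) (y : T -> 'I_n -> q.-tuple R) :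
  measurable_fun setT f -> measurable_fun setT g ->
  (forall s, measurable_fun setT (x^~ s)) -> (forall s, measurable_fun setT (y^~ s)) ->
  measurable_fun setT (fun w => hcov2 f g (x w) (y w)).
Proof.
move=> mf mg mx my; rewrite /hcov2 /udot.
apply: measurable_funM; first exact: measurable_cst.
apply: measurable_sum => s; under eq_fun do rewrite big_mkcond.
apply: measurable_sum => t; case: (s != t); last exact: measurable_cst.
by apply: measurable_funM; apply: measurable_fun_ucenter; exact: measurable_fun_kernel_mx.
Qed.

(** The U-centered form is used, as it is free of the sum over permutations. *)
Lemma measurable_fun_cov2 (n_ge4 : (4 <= n)%N) (x y : T -> 'I_n -> R) :
  (forall s, measurable_fun setT (x^~ s)) -> (forall s, measurable_fun setT (y^~ s)) ->
  measurable_fun setT (fun w => cov2 (x w) (y w)).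
Proof.
move=> mx my; under eq_fun do rewrite cov2_ucenter //.
apply: measurable_funM; first exact: measurable_cst.
apply: measurable_funM; first exact: measurable_cst.
apply: measurable_sum => s; under eq_fun do rewrite big_mkcond.
apply: measurable_sum => t; case: (s != t); last exact: measurable_cst.
apply: measurable_funM; apply: measurable_fun_ucenter => i j;
  under eq_fun do rewrite mxE; by apply: measurable_funX; apply: measurable_funB.
Qed.

End Measurability.

(** * Laws of pairs *)

Section SecondMoments.
Context {d : measure_display} {T : measurableType d} {R : realType}.
Variable P : probability T R.
Implicit Types X : T -> R.

Lemma Lfun2_sqr_expectation X : measurable_fun setT X ->
  ('E_P[(fun w => X w ^+ 2)%R] < +oo)%E -> X \in Lfun P 2%:E.
Proof.
move=> mX X2; rewrite inE; apply/andP; split; rewrite inE //=.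
rewrite /finite_norm unlock poweR_lty //.
move: X2; rewrite unlock; apply: le_lt_trans; rewrite le_eqVlt; apply/orP; left.
apply/eqP; apply: eq_integral => w _.
by rewrite /= powR_mulrn // real_normK ?num_real.
Qed.

(** The variance is invariant under the shift by [c], and the squared mean is dropped. *)
Lemma variance_le_expectation_sqr X c : X \in Lfun P 2%:E ->
  ('V_P[X] <= 'E_P[(fun w => (X w - c) ^+ 2)%R])%E.
Proof.
move=> X2; rewrite -(varianceB_cst_r c) // varianceE; last first.
  have c2 : cst (- c) \in Lfun P 2%:E by exact: Lfun_cst.
  by rewrite (_ : X \- cst c = X \+ (cst (- c))) // rpredD ?lee1n.
rewrite (_ : ((X \- cst c) ^+ 2)%R = fun w => (X w - c) ^+ 2).
  by apply: geeDl; rewrite oppe_le0 sqre_ge0.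
by apply/funext => w; rewrite /= !expr2.
Qed.

Context {d' : measure_display} {T' : measurableType d'}.
Implicit Types U V Z : {RV P >-> T'}.

(** A measure on the product is determined by its values on rectangles. This serves both the pair of
    the population with its copy and the pairs from the sample, which hence have the same law. *)
Lemma joint_law Z U V :
  (forall A, measurable A -> P (U @^-1` A) = P (Z @^-1` A)) ->
  (forall A, measurable A -> P (V @^-1` A) = P (Z @^-1` A)) ->
  (forall A B, measurable A -> measurable B ->
     P (U @^-1` A `&` V @^-1` B) = (P (U @^-1` A) * P (V @^-1` B))%E) ->
  forall B : set (T' * T'), measurable B ->
  P ((fun w => (U w, V w)) @^-1` B) =
  (distribution P Z \x distribution P Z)%E B.
Proof.
move=> UZ VZ UV B mB.
have mUV : measurable_fun setT (fun w => (U w, V w)).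
  by apply: measurable_fun_pair.
pose W : {mfun T >-> (T' * T')%type} := HB.pack (fun w => (U w, V w))
  (isMeasurableFun.Build _ _ _ _ _ mUV).
rewrite (@product_measure_unique _ _ _ _ _ _ _ (distribution P W)) //.
move=> A C mA mC; transitivity (P (Z @^-1` A) * P (Z @^-1` C))%E => //.
by rewrite -UZ // -VZ // -UV.
Qed.

Lemma integral_joint_law Z U V (F : T' * T' -> \bar R) :
  (forall A, measurable A -> P (U @^-1` A) = P (Z @^-1` A)) ->
  (forall A, measurable A -> P (V @^-1` A) = P (Z @^-1` A)) ->
  (forall A B, measurable A -> measurable B ->
     P (U @^-1` A `&` V @^-1` B) = (P (U @^-1` A) * P (V @^-1` B))%E) ->
  measurable_fun setT F -> (forall z, 0 <= F z)%E ->
  (\int[P]_w F (U w, V w) =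
   \int[distribution P Z]_x \int[distribution P Z]_y F (x, y))%E.
Proof.
move=> UZ VZ UV mF F0; rewrite -[RHS]fubini_tonelli1 //.
have mUV : measurable_fun setT (fun w => (U w, V w)).
  by apply: measurable_fun_pair.
pose W : {mfun T >-> (T' * T')%type} := HB.pack (fun w => (U w, V w))
  (isMeasurableFun.Build _ _ _ _ _ mUV).
rewrite -(ge0_integral_distribution W) //.
by apply: eq_measure_integral => A mA _; exact: joint_law.
Qed.

Lemma expectation_same_law U V (phi : T' -> R) :
  (forall A, measurable A -> P (V @^-1` A) = P (U @^-1` A)) ->
  measurable_fun setT phi -> (forall z, 0 <= phi z) ->
  ('E_P[(fun w => phi (V w))] = 'E_P[(fun w => phi (U w))])%E.
Proof.
move=> VU mphi phi0; rewrite unlock.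
have mE : measurable_fun setT (EFin \o phi) by exact/measurable_EFinP.
have E0 z : (0 <= (EFin \o phi) z)%E by rewrite lee_fin.
rewrite -(ge0_integral_distribution V mE E0) -(ge0_integral_distribution U mE E0).
by apply: eq_measure_integral => A mA _; exact: VU.
Qed.

Variables (U V : {RV P >-> T'}) (UV : independent_copy U V).

(** From [(u - v)^2 <= 2 (u^2 + v^2)]. It makes the expected squared distance finite, so that [fine]
    does not return its default. *)
Lemma expectation_sqr_diff_le (phi : T' -> R) (b : R) :
  measurable_fun setT phi -> ('E_P[(fun w => phi (U w) ^+ 2)%R] <= b%:E)%E ->
  ('E_P[(fun w => (phi (U w) - phi (V w)) ^+ 2)%R] <= (2 * (b + b))%:E)%E.
Proof.
move=> mphi Ub.
have Vb : ('E_P[(fun w => phi (V w) ^+ 2)%R] <= b%:E)%E.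
  have mphi2 : measurable_fun setT (fun z => phi z ^+ 2) by exact: measurable_funX.
  by rewrite (expectation_same_law UV.1 mphi2 (fun z => sqr_ge0 (phi z))).
have mU : measurable_fun setT (fun w => phi (U w)) by apply: measurableT_comp.
have mV : measurable_fun setT (fun w => phi (V w)) by apply: measurableT_comp.
move: Ub Vb; rewrite unlock => Ub Vb.
apply: (@le_trans _ _ (\int[P]_w (2%:E * ((phi (U w) ^+ 2)%:E + (phi (V w) ^+ 2)%:E)))%E).
  apply: ge0_le_integral => //.
  - by move=> w _; rewrite lee_fin sqr_ge0.
  - by apply/measurable_EFinP; apply: measurable_funX; apply: measurable_funB.
  - apply/measurable_EFinP; apply: measurable_funM => //.
    by apply: measurable_funD; apply: measurable_funX.
  - move=> w _; rewrite -EFinD -EFinM lee_fin.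
    have := sqr_ge0 (phi (U w) + phi (V w)); nra.
rewrite ge0_integralZl_EFin //; last 2 first.
- by move=> w _; rewrite -EFinD lee_fin addr_ge0 ?sqr_ge0.
- by apply/measurable_EFinP; apply: measurable_funD; apply: measurable_funX.
rewrite ge0_integralD //; last 4 first.
- by move=> w _; rewrite lee_fin sqr_ge0.
- by apply/measurable_EFinP; apply: measurable_funX.
- by move=> w _; rewrite lee_fin sqr_ge0.
- by apply/measurable_EFinP; apply: measurable_funX.
rewrite EFinM; apply: lee_wpmul2l; first by rewrite lee_fin.
by rewrite EFinD; exact: leeD.
Qed.

(** By independence and Tonelli the right side averages, over [x], the mean square of
    [phi x - phi U], and each of these is at least the variance. *)
Lemma variance_le_sqr_diff (phi : T' -> R) :
  measurable_fun setT phi -> ('E_P[(fun w => phi (U w) ^+ 2)%R] < +oo)%E ->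
  ('V_P[(fun w => phi (U w))] <=
   'E_P[(fun w => (phi (U w) - phi (V w)) ^+ 2)%R])%E.
Proof.
move=> mphi Uoo.
have mU : measurable_fun setT (fun w => phi (U w)) by apply: measurableT_comp.
have U2 := Lfun2_sqr_expectation mU Uoo.
have mF : measurable_fun setT (fun z : T' * T' => ((phi z.1 - phi z.2) ^+ 2)%:E).
  apply/measurable_EFinP; apply: measurable_funX; apply: measurable_funB.
    exact: measurableT_comp mphi measurable_fst.
  exact: measurableT_comp mphi measurable_snd.
have F0 (z : T' * T') : (0 <= ((phi z.1 - phi z.2) ^+ 2)%:E)%E.
  by rewrite lee_fin sqr_ge0.
have -> : ('E_P[(fun w => (phi (U w) - phi (V w)) ^+ 2)%R] =
    \int[P]_w ((phi (U w) - phi (V w)) ^+ 2)%:E)%E by rewrite unlock.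
rewrite (integral_joint_law (fun _ _ => erefl) UV.1 UV.2 mF F0).
have V_fin := variance_fin_num U2.
(* The variance becomes the integral of a constant against the law of [U], so the integrands can be
   compared pointwise. *)
rewrite -[leLHS]mule1 -(@probability_setT _ _ _ (distribution P U)) -integral_cst //.
apply: ge0_le_integral => //.
- by move=> x _; exact: variance_ge0.
- exact: (@measurable_fun_fubini_tonelli_F _ _ _ _ _ (distribution P U) _ mF F0).
move=> x _; rewrite /= (@ge0_integral_distribution _ _ _ _ _ P U
    (fun y => ((phi x - phi y) ^+ 2)%:E)); last 2 first.
- apply/measurable_EFinP; apply: measurable_funX; apply: measurable_funB => //.
- by move=> y; rewrite lee_fin sqr_ge0.
apply: le_trans (variance_le_expectation_sqr (phi x) U2) _.
rewrite unlock le_eqVlt; apply/orP; left; apply/eqP; apply: eq_integral => w _ /=.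
by rewrite -sqrrN opprB.
Qed.

(** The expectation splits over the coordinates into finite nonnegative terms, and that of [i0] is
    at least [a]. *)
Lemma expectation_sqr_edist_gt0 (p : nat) (h : T' -> p.-tuple R) (a b : R) (i0 : 'I_p) :
  measurable_fun setT h -> 0 < a ->
  (forall i, a%:E <= 'V_P[(fun w => tnth (h (U w)) i)])%E ->
  (forall i, 'E_P[(fun w => tnth (h (U w)) i ^+ 2)%R] <= b%:E)%E ->
  0 < fine 'E_P[(fun w => Defs.edist (h (U w)) (h (V w)) ^+ 2)%R]%E.
Proof.
move=> mh a0 aV Eb.
have mphi i : measurable_fun setT (fun z => tnth (h z) i).
  exact: (measurableT_comp (measurable_tnth i) mh).
have mU i : measurable_fun setT (fun w => tnth (h (U w)) i).
  exact: (measurableT_comp (mphi i)).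
have mV i : measurable_fun setT (fun w => tnth (h (V w)) i).
  exact: (measurableT_comp (mphi i)).
have mD i : measurable_fun setT
    (fun w => ((tnth (h (U w)) i - tnth (h (V w)) i) ^+ 2)%:E).
  by apply/measurable_EFinP; apply: measurable_funX; apply: measurable_funB.
have -> : ('E_P[(fun w => Defs.edist (h (U w)) (h (V w)) ^+ 2)%R] =
    \sum_(i < p) 'E_P[(fun w => (tnth (h (U w)) i - tnth (h (V w)) i) ^+ 2)%R])%E.
  rewrite unlock; under eq_integral => w _.
    rewrite /Defs.edist sqr_sqrtr; last by apply: sumr_ge0 => i _; exact: sqr_ge0.
    rewrite -sumEFin; over.
  rewrite ge0_integral_sum // => i w _; by rewrite lee_fin sqr_ge0.
have Efin i : ('E_P[(fun w => (tnth (h (U w)) i - tnth (h (V w)) i) ^+ 2)%R] \is a fin_num)%E.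
  rewrite ge0_fin_numE; last by apply: expectation_ge0 => w; exact: sqr_ge0.
  apply: le_lt_trans (expectation_sqr_diff_le (mphi i) (Eb i)) _; exact: ltry.
rewrite fine_gt0 //; apply/andP; split; last first.
  by apply: lte_sum_pinfty => i _; rewrite ltey_eq Efin.
rewrite (bigD1 i0) //=; apply: (@lt_le_trans _ _ a%:E); first by rewrite lte_fin.
rewrite -[leLHS]adde0; apply: leeD; last first.
  by apply: sume_ge0 => i _; apply: expectation_ge0 => w; exact: sqr_ge0.
apply: le_trans (aV i0) _; apply: (variance_le_sqr_diff (mphi i0)).
apply: le_lt_trans (Eb i0) _; exact: ltry.
Qed.

End SecondMoments.

(** * Simultaneous control of the deviations of all sample pairs *)

Section SampleDeviations.
Context {d d' : measure_display} {T : measurableType d} {T' : measurableType d'}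
  {R : realType}.
Variable P : probability T R.

Lemma measure_bigsetU_le (I : Type) (s : seq I) (A : I -> set T) (c : R) :
  (forall i, measurable (A i)) -> (forall i, P (A i) <= c%:E)%E ->
  (P (\big[setU/set0]_(i <- s) A i) <= ((size s)%:R * c)%:E)%E.
Proof.
move=> mA Ac; elim: s => [|i s IH]; first by rewrite big_nil measure0 mul0r.
rewrite big_cons /= -natr1 mulrDl mul1r addrC EFinD.
have ms : measurable (\big[setU/set0]_(i <- s) A i) by exact: bigsetU_measurable.
apply: le_trans (measureU2 P (mA i) ms) _; exact: leeD (Ac i) IH.
Qed.

Variables (n p : nat) (Z Z' : {RV P >-> T'}) (S : 'I_n -> {RV P >-> T'}).
Hypotheses (ZZ' : independent_copy Z Z') (ZS : iid_copies Z S).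
Variables (h : T' -> p.-tuple R) (mh : measurable_fun setT h) (tau : R).

Lemma iid_pair s t : s != t -> forall A B, measurable A -> measurable B ->
  P (S s @^-1` A `&` S t @^-1` B) = (P (S s @^-1` A) * P (S t @^-1` B))%E.
Proof.
move=> st A B mA mB; have [_ prodS] := ZS.
(* Events that are trivial outside [s] and [t] reduce the product rule of the family to the pair. *)
pose C i := if i == s then A else if i == t then B else setT.
have := prodS C; rewrite (bigD1 s) //= (bigD1 t) //=; last by rewrite eq_sym.
rewrite /C eqxx eqxx eq_sym (negPf st) big1 => [|i /andP[/negPf-> /negPf->]]; last first.
  by rewrite preimage_setT probability_setT.
rewrite mule1 => <-; last by move=> i; case: ifP => // _; case: ifP.
congr (P _); apply/seteqP; split => w /=.
  by move=> [wA wB] i _; case: ifP => [/eqP->//|_]; case: ifP => [/eqP->//|].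
move=> wC; split; first by have := wC s I; rewrite eqxx.
by have := wC t I; rewrite eq_sym (negPf st) eqxx.
Qed.

(** Both sides are the probability that a pair falls in the same measurable set [B], and the two
    pairs have the same law. *)
Lemma relvar_law s t c : s != t ->
  P [set w | c < `|relvar tau (fun i => h (S i w)) s t| ] =
  P [set w | c < `|(Defs.edist (h (Z w)) (h (Z' w)) ^+ 2 - tau ^+ 2) / tau ^+ 2| ].
Proof.
move=> st; pose B := [set z : T' * T' |
  c < `|(Defs.edist (h z.1) (h z.2) ^+ 2 - tau ^+ 2) / tau ^+ 2| ].
have mB : measurable B.
  apply: measurable_ltr_set; first exact: measurable_cst.
  apply: measurableT_comp => //; apply: measurable_funM; last exact: measurable_cst.
  apply: measurable_funB; last exact: measurable_cst.
  apply: measurable_funX; apply: measurable_fun_edist.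
    exact: (measurableT_comp mh measurable_fst).
  exact: (measurableT_comp mh measurable_snd).
have := joint_law (ZS.1 s) (ZS.1 t) (iid_pair st) mB.
have <- := joint_law (fun _ _ => erefl) ZZ'.1 ZZ'.2 mB => BE.
transitivity (P ((fun w => (S s w, S t w)) @^-1` B)); last exact: BE.
by congr (P _); apply/seteqP; split => w /=; rewrite mxE (negPf st).
Qed.

(** The bad event, as a finite union ready for the union bound; the diagonal is left out because
    [relvar] vanishes there. *)
Definition deviating (c : R) : set T :=
  \big[setU/set0]_(st <- enum {: 'I_n * 'I_n} | st.1 != st.2)
    [set w | c < `|relvar tau (fun i => h (S i w)) st.1 st.2| ].

Lemma deviatingP c w : 0 <= c -> ~ deviating c w ->
  forall s t, `|relvar tau (fun i => h (S i w)) s t| <= c.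
Proof.
move=> c0 ndev s t; case: (eqVneq s t) => [->|st].
  by rewrite mxE eqxx normr0.
rewrite leNgt; apply/negP => cst; apply: ndev.
rewrite /deviating -bigcup_seq_cond; exists (s, t) => //=.
by rewrite mem_enum.
Qed.

Lemma measurable_deviating c : measurable (deviating c).
Proof.
apply: bigsetU_measurable => st _; apply: measurable_ltr_set.
  exact: measurable_cst.
apply: measurableT_comp => //; under eq_fun do rewrite mxE.
case: eqP => _; first exact: measurable_cst.
apply: measurable_funM; last exact: measurable_cst.
apply: measurable_funB; last exact: measurable_cst.
by apply: measurable_funX; apply: measurable_fun_edist; apply: measurableT_comp.
Qed.

Lemma deviating_le c e :
  (P [set w | (c < `|(Defs.edist (h (Z w)) (h (Z' w)) ^+ 2 - tau ^+ 2) / tau ^+ 2|)%R ]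
     <= e%:E)%E -> (P (deviating c) <= ((n * n)%:R * e)%:E)%E.
Proof.
(* Padding with [set0] on the diagonal lets the union run over all [n * n] pairs. *)
move=> Le; pose A (st : 'I_n * 'I_n) := if st.1 != st.2 then
  [set w | c < `|relvar tau (fun i => h (S i w)) st.1 st.2| ] else set0.
have -> : deviating c = \big[setU/set0]_(st <- enum {: 'I_n * 'I_n}) A st.
  by rewrite /deviating big_mkcond.
have := @measure_bigsetU_le _ (enum {: 'I_n * 'I_n}) A e.
rewrite -cardE card_prod card_ord; apply => -[s t]; rewrite /A /=.
  case: ifP => // st; apply: measurable_ltr_set; first exact: measurable_cst.
  apply: measurableT_comp => //; under eq_fun do rewrite mxE (negPf st).
  apply: measurable_funM; last exact: measurable_cst.
  apply: measurable_funB; last exact: measurable_cst.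
  by apply: measurable_funX; apply: measurable_fun_edist; apply: measurableT_comp.
case: ifP => [st|_]; first by rewrite relvar_law.
(* The empty set is covered since [0 <= e] follows from [Le]. *)
by rewrite measure0 (le_trans _ Le).
Qed.

End SampleDeviations.

(** * Stochastic orders *)

Section ModelFacts.
Variables (R : realType) (n : nat) (n_ge4 : (4 <= n)%N).

Section OneModel.
Variables (p q : nat) (M : model R n p q).

Lemma measurable_sampleX s : measurable_fun setT (fun w : Omega M => sampleX w s).
Proof. by apply: measurableT_comp => //; exact: measurable_fst. Qed.

Lemma measurable_sampleY s : measurable_fun setT (fun w : Omega M => sampleY w s).
Proof. by apply: measurableT_comp => //; exact: measurable_snd. Qed.

Lemma measurable_derivative_factor (f g : R -> R) :
  continuous (derive1 f) -> continuous (derive1 g) ->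
  measurable_fun setT (derivative_factor M f g).
Proof.
move=> cf cg.
have mX : measurable_fun setT (fun w : Omega M => tauX M / bandwidth (sampleX w)).
  apply: measurable_funM; first exact: measurable_cst.
  by apply: measurable_funV; apply: measurable_fun_bandwidth => s; exact: measurable_sampleX.
have mY : measurable_fun setT (fun w : Omega M => tauY M / bandwidth (sampleY w)).
  apply: measurable_funM; first exact: measurable_cst.
  by apply: measurable_funV; apply: measurable_fun_bandwidth => s; exact: measurable_sampleY.
apply: measurable_funM => //; apply: measurable_funM => //; apply: measurable_funM.
  exact: (measurableT_comp (continuous_measurable_fun cf) mX).
exact: (measurableT_comp (continuous_measurable_fun cg) mY).
Qed.

Lemma measurable_scaled_cov_sum : measurable_fun setT (scaled_cov_sum M).
Proof.
apply: measurable_funM; first exact: measurable_cst.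
apply: measurable_sum => i; apply: measurable_sum => j.
apply: measurable_fun_cov2 => // s.
  exact: (measurableT_comp (measurable_tnth i) (measurable_sampleX s)).
exact: (measurableT_comp (measurable_tnth j) (measurable_sampleY s)).
Qed.

Lemma measurable_hCov2 (f g : R -> R) :
  (forall x, derivable f x 1) -> (forall x, derivable g x 1) ->
  measurable_fun setT (hCov2 M f g).
Proof.
have mder (k : R -> R) : (forall x, derivable k x 1) -> measurable_fun setT k.
  move=> dk; apply: continuous_measurable_fun => x; apply: differentiable_continuous.
  by apply/derivable1_diffP.
move=> df dg; apply: measurable_fun_hcov2; try exact: mder.
- exact: measurable_sampleX.
- exact: measurable_sampleY.
Qed.

Lemma tauX_gt0 (a b : R) : (0 < p)%N -> 0 < a ->
  (forall i : 'I_p, (a%:E <= 'V_(Pr M)[coordX M i])%E) ->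
  (forall i : 'I_p, ('E_(Pr M)[(fun w => coordX M i w ^+ 2)%R] <= b%:E)%E) ->
  0 < tauX M.
Proof.
move=> p0 a0 aV Eb; rewrite /tauX sqrtr_gt0.
exact: (expectation_sqr_edist_gt0 (copyP M) (Ordinal p0) measurable_fst a0 aV Eb).
Qed.

Lemma tauY_gt0 (a b : R) : (0 < q)%N -> 0 < a ->
  (forall j : 'I_q, (a%:E <= 'V_(Pr M)[coordY M j])%E) ->
  (forall j : 'I_q, ('E_(Pr M)[(fun w => coordY M j w ^+ 2)%R] <= b%:E)%E) ->
  0 < tauY M.
Proof.
move=> q0 a0 aV Eb; rewrite /tauY sqrtr_gt0.
exact: (expectation_sqr_edist_gt0 (copyP M) (Ordinal q0) measurable_snd a0 aV Eb).
Qed.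

(** The outcomes to which the deterministic bounds apply, with [dX] and [dY] later the multiples
    [C * ap] and [C * bq]. *)
Definition regular (dX dY : R) (w : Omega M) : Prop :=
  (forall s t, `|relvar (tauX M) (sampleX w) s t| <= dX) /\
  (forall s t, `|relvar (tauY M) (sampleY w) s t| <= dY).

(** One union bound over [n * n] pairs for each of X and Y. The exceptional set [B] is measurable,
    so that probabilities may be compared with it. *)
Lemma regular_whp (dX dY e : R) : 0 <= dX -> 0 <= dY ->
  (Pr M [set w | (dX < `|LX M w|)%R ] <= e%:E)%E ->
  (Pr M [set w | (dY < `|LY M w|)%R ] <= e%:E)%E ->
  exists B, [/\ measurable B, (Pr M B <= (2 * (n * n)%:R * e)%:E)%E &
    forall w, ~ B w -> regular dX dY w].
Proof.
move=> dX0 dY0 PX PY.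
pose BX := deviating (sample M) fst (tauX M) dX.
pose BY := deviating (sample M) snd (tauY M) dY.
have mBX : measurable BX by apply: measurable_deviating; exact: measurable_fst.
have mBY : measurable BY by apply: measurable_deviating; exact: measurable_snd.
exists (BX `|` BY); split; first exact: measurableU.
  apply: le_trans (measureU2 (Pr M) mBX mBY) _.
  rewrite -mulrA mulrDl mul1r EFinD; apply: leeD.
    exact: (deviating_le (copyP M) (sampleP M) measurable_fst PX).
  exact: (deviating_le (copyP M) (sampleP M) measurable_snd PY).
move=> w /not_orP[nX nY]; split.
  exact: (deviatingP dX0 nX).
exact: (deviatingP dY0 nY).
Qed.

End OneModel.

Variable M : forall p q, model R n p q.
Implicit Types (ap bq : nat -> R).

Let pq_oo_filter : Filter pq_oo := filter_prod_filter _ _.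
Existing Instance pq_oo_filter.

(** The passage from deterministic to stochastic bounds: an event that no regular outcome satisfies
    is contained in the exceptional set. First [C] is found from [e], then [c] from [C]. *)
Lemma near_regular_le ap bq (Q : R -> forall p q, set (Omega (M p q))) :
  (forall p, 0 <= ap p) -> (forall q, 0 <= bq q) ->
  bigOp M (fun p q => LX (M p q)) (fun p q => ap p) ->
  bigOp M (fun p q => LY (M p q)) (fun p q => bq q) ->
  (forall c p q, measurable (Q c p q)) ->
  (forall C, 0 <= C -> exists c, \forall pq \near pq_oo, forall w,
     regular (C * ap pq.1) (C * bq pq.2) w -> ~ Q c pq.1 pq.2 w) ->
  forall e, 0 < e -> exists c, \forall pq \near pq_oo,
    (Pr (M pq.1 pq.2) (Q c pq.1 pq.2) <= e%:E)%E.
Proof.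
move=> ap0 bq0 HX HY mQ HQ e e0.
have n0 : 0 < (n * n)%:R :> R by rewrite ltr0n muln_gt0 (leq_trans _ n_ge4).
(* Compensates the factor lost in [regular_whp]. *)
pose e' := e / (2 * (n * n)%:R).
have e'0 : 0 < e' by rewrite divr_gt0 // mulr_gt0.
have [CX HCX] := HX e' e'0; have [CY HCY] := HY e' e'0.
pose C := `|CX| + `|CY|.
have C0 : 0 <= C by rewrite addr_ge0.
have [c Hc] := HQ C C0; exists c.
near=> pq.
(* Enlarging the constant shrinks the event, so a single [C] serves both X and Y. *)
have mono (h : Omega (M pq.1 pq.2) -> R) D a : measurable_fun setT h -> 0 <= a -> D <= C ->
    (Pr (M pq.1 pq.2) [set w | (D * `|a| < `|h w|)%R] <= e'%:E)%E ->
    (Pr (M pq.1 pq.2) [set w | (C * a < `|h w|)%R] <= e'%:E)%E.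
  move=> mh a0 DC; apply: le_trans.
  have mset c' : measurable [set w | (c' < `|h w|)%R].
    apply: measurable_ltr_set; first exact: measurable_cst.
    exact: measurableT_comp.
  apply: le_measure; rewrite ?inE //.
  move=> w /=; apply: le_lt_trans; rewrite ger0_norm // ler_wpM2r //.
have mLX : measurable_fun setT (LX (M pq.1 pq.2)).
  apply: measurable_funM; last exact: measurable_cst.
  apply: measurable_funB; last exact: measurable_cst.
  apply: measurable_funX; apply: measurable_fun_edist;
    by apply: measurableT_comp => //; exact: measurable_fst.
have mLY : measurable_fun setT (LY (M pq.1 pq.2)).
  apply: measurable_funM; last exact: measurable_cst.
  apply: measurable_funB; last exact: measurable_cst.
  apply: measurable_funX; apply: measurable_fun_edist;
    by apply: measurableT_comp => //; exact: measurable_snd.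
have PX : (Pr (M pq.1 pq.2) [set w | (C * ap pq.1 < `|LX (M pq.1 pq.2) w|)%R ] <= e'%:E)%E.
  apply: (mono _ CX) => //; last by near: pq.
  by apply: le_trans (ler_norm _) _; rewrite lerDl.
have PY : (Pr (M pq.1 pq.2) [set w | (C * bq pq.2 < `|LY (M pq.1 pq.2) w|)%R ] <= e'%:E)%E.
  apply: (mono _ CY) => //; last by near: pq.
  by apply: le_trans (ler_norm _) _; rewrite lerDr.
have [B [mB PB BQ]] := regular_whp (mulr_ge0 C0 (ap0 _)) (mulr_ge0 C0 (bq0 _)) PX PY.
have eE : e = 2 * (n * n)%:R * e' by rewrite [RHS]mulrC divfK // gt_eqF // mulr_gt0.
rewrite -eE in PB; apply: le_trans PB; apply: le_measure; rewrite ?inE //.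
have Hw : forall w, regular (C * ap pq.1) (C * bq pq.2) w -> ~ Q c pq.1 pq.2 w.
  by near: pq.
by move=> w Qw; apply: contrapT => /BQ /Hw.
Unshelve. all: by end_near. Qed.

Lemma bigOp_of_regular (Z : forall p q, Omega (M p q) -> R) (a : nat -> nat -> R) ap bq :
  (forall p, 0 <= ap p) -> (forall q, 0 <= bq q) ->
  bigOp M (fun p q => LX (M p q)) (fun p q => ap p) ->
  bigOp M (fun p q => LY (M p q)) (fun p q => bq q) ->
  (forall p q, measurable_fun setT (@Z p q)) ->
  (forall C, 0 <= C -> exists c, \forall pq \near pq_oo, forall w,
     regular (C * ap pq.1) (C * bq pq.2) w -> `|Z pq.1 pq.2 w| <= c * `|a pq.1 pq.2|) ->
  bigOp M Z a.
Proof.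
move=> ap0 bq0 HX HY mZ HZ.
move=> e e0; apply: (near_regular_le
  (Q := fun c p q => [set w | c * `|a p q| < `|Z p q w|])
  ap0 bq0 HX HY _ _ e0) => [c p q|C C0].
  apply: measurable_ltr_set; first exact: measurable_cst.
  exact: measurableT_comp.
have [c Hc] := HZ C C0; exists c; near=> pq.
have Hw : forall w, regular (C * ap pq.1) (C * bq pq.2) w ->
    `|Z pq.1 pq.2 w| <= c * `|a pq.1 pq.2| by near: pq.
by move=> w /Hw /=; rewrite leNgt => /negP.
Unshelve. all: by end_near. Qed.

Lemma littleop_of_regular (Z : forall p q, Omega (M p q) -> R) (a : nat -> nat -> R) ap bq :
  (forall p, 0 <= ap p) -> (forall q, 0 <= bq q) ->
  bigOp M (fun p q => LX (M p q)) (fun p q => ap p) ->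
  bigOp M (fun p q => LY (M p q)) (fun p q => bq q) ->
  (forall p q, measurable_fun setT (@Z p q)) ->
  (forall C e, 0 <= C -> 0 < e -> \forall pq \near pq_oo, forall w,
     regular (C * ap pq.1) (C * bq pq.2) w -> `|Z pq.1 pq.2 w| <= e * `|a pq.1 pq.2|) ->
  littleop M Z a.
Proof.
move=> ap0 bq0 HX HY mZ HZ e e0.
have mQ (c : R) p q : measurable [set w | (e * `|a p q| < `|Z p q w|)%R].
  apply: measurable_ltr_set; first exact: measurable_cst.
  exact: measurableT_comp.
(* Convergence of extended reals is reduced to that of the real values, the probabilities being
   finite. *)
apply/fine_cvgP; split; first by near=> pq; exact: (fin_num_measure (Pr _) _ (mQ 0 _ _)).
apply/cvgrPdist_le => e' e'0.
have [C C0|_ H] := near_regular_le ap0 bq0 HX HY mQ _ e'0.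
  (* The event here does not depend on [c], so any value will do. *)
  exists 0; near=> pq.
  have Hw : forall w, regular (C * ap pq.1) (C * bq pq.2) w ->
      `|Z pq.1 pq.2 w| <= e * `|a pq.1 pq.2| by near: pq; exact: HZ.
  by move=> w /Hw /=; rewrite leNgt => /negP.
apply: filterS H => pq Hpq; rewrite /= sub0r normrN [leLHS]ger0_norm ?fine_ge0 //.
by rewrite -lee_fin fineK //; exact: (fin_num_measure (Pr _) _ (mQ 0 _ _)).
Unshelve. all: by end_near. Qed.

End ModelFacts.

(** * Eventual smallness as both dimensions grow *)

Section NearInfinity.
Variable R : realType.

Lemma near_pq_small1 (u : nat -> R) (C e : R) : u @ \oo --> (0 : R) -> 0 < e ->
  \forall pq \near pq_oo, C * u pq.1 <= e.
Proof.
move=> u0 e0; have : (fun p => C * u p) @ \oo --> C * 0 by apply: cvgMr.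
rewrite mulr0 => /cvgrPdist_le /(_ e e0) H.
have {}H : \forall p \near \oo, C * u p <= e.
  apply: filterS H => p; rewrite sub0r normrN; apply: le_trans; exact: ler_norm.
exact: (cvg_fst H).
Qed.

Lemma near_pq_small2 (u : nat -> R) (C e : R) : u @ \oo --> (0 : R) -> 0 < e ->
  \forall pq \near pq_oo, C * u pq.2 <= e.
Proof.
move=> u0 e0; have : (fun p => C * u p) @ \oo --> C * 0 by apply: cvgMr.
rewrite mulr0 => /cvgrPdist_le /(_ e e0) H.
have {}H : \forall p \near \oo, C * u p <= e.
  apply: filterS H => p; rewrite sub0r normrN; apply: le_trans; exact: ler_norm.
exact: (cvg_snd H).
Qed.

Lemma near_pq_small (u : nat * nat -> R) (C e : R) :
  u pq @[pq --> pq_oo] --> (0 : R) -> 0 < e ->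
  \forall pq \near pq_oo, C * u pq <= e.
Proof.
move=> u0 e0; have pq_oo_filter : Filter pq_oo by exact: filter_prod_filter.
have : (fun pq => C * u pq) @ pq_oo --> C * 0 by apply: cvgMr.
rewrite mulr0 => /cvgrPdist_le /(_ e e0); apply: filterS => pq.
by rewrite sub0r normrN; apply: le_trans; exact: ler_norm.
Qed.

Lemma near_pq_gt0 : \forall pq \near pq_oo, (0 < pq.1)%N /\ (0 < pq.2)%N.
Proof.
have pq_oo_filter : Filter pq_oo by exact: filter_prod_filter.
apply: filterI.
  exact: (cvg_fst (nbhs_infty_gt 0)).
exact: (cvg_snd (nbhs_infty_gt 0)).
Qed.

End NearInfinity.

(** * The decomposition and the stochastic orders of its terms *)

Theorem theorem2p1p2 (R : realType) (n : nat) (n_ge4 : (4 <= n)%N)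
  (M : forall p q : nat, model R n p q)
  (f g : R -> R)
  (f_derivable : forall x : R, derivable f x 1)
  (f'_continuous : continuous (derive1 f))
  (g_derivable : forall x : R, derivable g x 1)
  (g'_continuous : continuous (derive1 g))
  (a b a' b' : R)
  (a_gt0 : 0 < a)
  (a'_gt0 : 0 < a')
  (varX_ge : forall (p q : nat) (i : 'I_p),
     (a%:E <= 'V_(Pr (M p q))[coordX (M p q) i])%E)
  (momX_le : forall (p q : nat) (i : 'I_p),
     ('E_(Pr (M p q))[(fun w => coordX (M p q) i w ^+ 2)%R] <= b%:E)%E)
  (varY_ge : forall (p q : nat) (j : 'I_q),
     (a'%:E <= 'V_(Pr (M p q))[coordY (M p q) j])%E)
  (momY_le : forall (p q : nat) (j : 'I_q),
     ('E_(Pr (M p q))[(fun w => coordY (M p q) j w ^+ 2)%R] <= b'%:E)%E) :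
  exists Rn : forall p q : nat, Omega (M p q) -> R,
    (forall (p q : nat) (w : Omega (M p q)),
       tau (M p q) * hCov2 (M p q) f g w =
       derivative_factor (M p q) f g w * scaled_cov_sum (M p q) w + Rn p q w)
    /\
    (forall ap bq : nat -> R,
       (forall p : nat, 0 <= ap p) ->
       (forall q : nat, 0 <= bq q) ->
       bigOp M (fun p q => LX (M p q)) (fun p q => ap p) ->
       bigOp M (fun p q => LY (M p q)) (fun p q => bq q) ->
       ap @ \oo --> (0 : R) ->
       bq @ \oo --> (0 : R) ->
       tauX (M pq.1 pq.2) ^+ 2 * ap pq.1 ^+ 3 @[pq --> pq_oo] --> (0 : R) ->
       tauY (M pq.1 pq.2) ^+ 2 * bq pq.2 ^+ 3 @[pq --> pq_oo] --> (0 : R) ->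
       tau (M pq.1 pq.2) * ap pq.1 ^+ 2 * bq pq.2 @[pq --> pq_oo]
         --> (0 : R) ->
       tau (M pq.1 pq.2) * ap pq.1 * bq pq.2 ^+ 2 @[pq --> pq_oo]
         --> (0 : R) ->
       [/\ (derive1 f 1 != 0 -> derive1 g 1 != 0 ->
              asymp_p M (fun p q => derivative_factor (M p q) f g)
                        (fun p q => 1)),
           bigOp M (fun p q => scaled_cov_sum (M p q))
                   (fun p q => tau (M p q) * ap p * bq q) &
           (deriv_lipschitz_at1 f -> deriv_lipschitz_at1 g ->
              [/\ bigOp M Rn (fun p q => tau (M p q) * ap p ^+ 2 * bq q
                                       + tau (M p q) * ap p * bq q ^+ 2),
                  littleop M Rn (fun p q => 1) &
                  littleop M Rn (fun p q => tau (M p q) * ap p * bq q)])]).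
Proof.
have pq_oo_filter : Filter pq_oo by exact: filter_prod_filter.
have n1 : (1 < n)%N by rewrite (leq_trans _ n_ge4).
(* The remainder is the difference of the two sides, so the identity holds by construction and the
   content is in the bounds. *)
exists (fun p q w => tau (M p q) * hCov2 (M p q) f g w -
  derivative_factor (M p q) f g w * scaled_cov_sum (M p q) w).
split=> [p q w|ap bq ap_ge0 bq_ge0 LXO LYO ap0 bq0 _ _ taab tabb].
  by rewrite addrC subrK.
set Rn := fun p q w => _ - _.
have mRn p q : measurable_fun setT (@Rn p q).
  apply: measurable_funB; apply: measurable_funM.
  - exact: measurable_cst.
  - exact: measurable_hCov2.
  - exact: measurable_derivative_factor.
  - exact: measurable_scaled_cov_sum.
(* Positivity takes at least one coordinate, so it is used only under [near_pq_gt0]. *)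
have tX0 p q : (0 < p)%N -> 0 < tauX (M p q).
  by move=> p0; exact: (tauX_gt0 p0 a_gt0 (@varX_ge p q) (@momX_le p q)).
have tY0 p q : (0 < q)%N -> 0 < tauY (M p q).
  by move=> q0; exact: (tauY_gt0 q0 a'_gt0 (@varY_ge p q) (@momY_le p q)).
have tau_ge0 p q : 0 <= tau (M p q) by rewrite mulr_ge0 ?sqrtr_ge0.
have tab_ge0 i j p q : 0 <= tau (M p q) * ap p ^+ i * bq q ^+ j.
  by apply: mulr_ge0; [apply: mulr_ge0 => //|]; exact: exprn_ge0.
split.
- move=> f1 g1.
  have [ef ef0 Hf] := derivative_factor_near f'_continuous f1.
  have [eg eg0 Hg] := derivative_factor_near g'_continuous g1.
  pose m := `|derive1 f 1| * `|derive1 g 1|.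
  have m0 : 0 < m by rewrite mulr_gt0 ?normr_gt0.
  (* On regular outcomes both arguments are near 1, so each of [f' cX * cX] and [g' cY * cY] is
     within a factor 2 of its value at 1. *)
  have DE C : \forall pq \near pq_oo, forall w,
      regular (M := M pq.1 pq.2) (C * ap pq.1) (C * bq pq.2) w ->
      m / 4 <= `|derivative_factor (M pq.1 pq.2) f g w| <= 4 * m.
    near=> pq.
    have [p0 q0] : (0 < pq.1)%N /\ (0 < pq.2)%N by near: pq; exact: near_pq_gt0.
    move=> w [wX wY].
    have aX2 : C * ap pq.1 <= 2^-1.
      by near: pq; apply: near_pq_small1 ap0 _; rewrite invr_gt0.
    have bY2 : C * bq pq.2 <= 2^-1.
      by near: pq; apply: near_pq_small2 bq0 _; rewrite invr_gt0.
    have aXf : 2 * C * ap pq.1 <= ef by near: pq; exact: near_pq_small1.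
    have bYg : 2 * C * bq pq.2 <= eg by near: pq; exact: near_pq_small2.
    have [cX _] := bandwidth_ratio n1 (tX0 _ _ p0) aX2 wX.
    have [cY _] := bandwidth_ratio n1 (tY0 _ _ q0) bY2 wY.
    have := Hf _ (le_trans cX _); rewrite mulrA => /(_ aXf) /andP[u1 u2].
    have := Hg _ (le_trans cY _); rewrite mulrA => /(_ bYg) /andP[v1 v2].
    rewrite /derivative_factor -mulrA mulrACA normrM.
    rewrite [m / 4](_ : _ = (`|derive1 f 1| / 2) * (`|derive1 g 1| / 2)); last first.
      by rewrite /m; field.
    rewrite [4 * m](_ : _ = (2 * `|derive1 f 1|) * (2 * `|derive1 g 1|)); last first.
      by rewrite /m; ring.
    by apply/andP; split; apply: ler_pM; rewrite ?divr_ge0.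
  have mD p q : measurable_fun setT (derivative_factor (M p q) f g).
    exact: measurable_derivative_factor.
  split.
    apply: (bigOp_of_regular n_ge4 ap_ge0 bq_ge0 LXO LYO mD) => C C0.
    exists (4 * m); apply: filterS (DE C) => pq Hpq w /Hpq /andP[_].
    by rewrite normr1 mulr1.
  move=> e e0; apply: (near_regular_le n_ge4
    (Q := fun c p q => [set w | c * `|derivative_factor (M p q) f g w| < `|1| ])
    ap_ge0 bq_ge0 LXO LYO _ _ e0) => [c p q|C C0].
    apply: measurable_ltr_set; last exact: measurable_cst.
    by apply: measurable_funM; [exact: measurable_cst|exact: measurableT_comp].
  (* The inverse of the lower bound [m / 4]. *)
  exists (4 / m); apply: filterS (DE C) => pq Hpq w /Hpq /andP[+ _] /=.
  rewrite normr1 => mD4; apply/negP; rewrite -leNgt.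
  rewrite mulrAC ler_pdivlMr // mul1r; lra.
- have [K K0 HK] := norm_sum_cov2_le R n_ge4.
  apply: (bigOp_of_regular n_ge4 ap_ge0 bq_ge0 LXO LYO) => [p q|C C0].
    exact: measurable_scaled_cov_sum.
  (* One factor [C] comes from each of the two deviations. *)
  exists (K * C ^+ 2); near=> pq.
  have [p0 q0] : (0 < pq.1)%N /\ (0 < pq.2)%N by near: pq; exact: near_pq_gt0.
  move=> w [wX wY]; rewrite [X in _ <= _ * X]ger0_norm; last exact: (tab_ge0 1 1).
  apply: le_trans (HK _ _ _ _ _ _ _ _ (tX0 _ _ p0) (tY0 _ _ q0) wX wY) _.
  by rewrite le_eqVlt; apply/orP; left; apply/eqP; rewrite /tau; ring.
- move=> lf lg.
  have [K [e1 [K0 e10 HK]]] := norm_remainder_le n_ge4 f_derivable lf g_derivable lg.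
  (* Each term of the bound is of total degree three in the deviations, hence [C ^+ 3]. *)
  have RnE C : 0 <= C -> \forall pq \near pq_oo, forall w,
      regular (M := M pq.1 pq.2) (C * ap pq.1) (C * bq pq.2) w ->
      `|Rn pq.1 pq.2 w| <= K * C ^+ 3 * (tau (M pq.1 pq.2) * ap pq.1 ^+ 2 * bq pq.2
        + tau (M pq.1 pq.2) * ap pq.1 * bq pq.2 ^+ 2).
    move=> C0; near=> pq.
    have [p0 q0] : (0 < pq.1)%N /\ (0 < pq.2)%N by near: pq; exact: near_pq_gt0.
    move=> w [wX wY].
    have aX : C * ap pq.1 <= e1 by near: pq; exact: near_pq_small1.
    have bY : C * bq pq.2 <= e1 by near: pq; exact: near_pq_small2.
    apply: le_trans (HK _ _ _ _ _ _ _ _ (tX0 _ _ p0) (tY0 _ _ q0) aX bY wX wY) _.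
    by rewrite le_eqVlt; apply/orP; left; apply/eqP; rewrite /tau; ring.
  split.
  + apply: (bigOp_of_regular n_ge4 ap_ge0 bq_ge0 LXO LYO mRn) => C C0.
    exists (K * C ^+ 3); apply: filterS (RnE C C0) => pq Hpq w /Hpq.
    rewrite [X in _ -> _ <= _ * X]ger0_norm // addr_ge0 //.
      exact: (tab_ge0 2 1).
    exact: (tab_ge0 1 2).
  + apply: (littleop_of_regular n_ge4 ap_ge0 bq_ge0 LXO LYO mRn) => C e C0 e0.
    have e20 : 0 < e / 2 by rewrite divr_gt0.
    near=> pq.
    have Hpq : forall w, regular (M := M pq.1 pq.2) (C * ap pq.1) (C * bq pq.2) w ->
      `|Rn pq.1 pq.2 w| <= K * C ^+ 3 * (tau (M pq.1 pq.2) * ap pq.1 ^+ 2 * bq pq.2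
        + tau (M pq.1 pq.2) * ap pq.1 * bq pq.2 ^+ 2) by near: pq; exact: RnE.
    (* The two terms tend to 0 by the rate assumptions on [tau], [ap] and [bq], and each takes half
       of [e]. *)
    have h1 : K * C ^+ 3 * (tau (M pq.1 pq.2) * ap pq.1 ^+ 2 * bq pq.2) <= e / 2.
      by near: pq; exact: near_pq_small.
    have h2 : K * C ^+ 3 * (tau (M pq.1 pq.2) * ap pq.1 * bq pq.2 ^+ 2) <= e / 2.
      by near: pq; exact: near_pq_small.
    by move=> w /Hpq; rewrite normr1 mulrDr; lra.
  + apply: (littleop_of_regular n_ge4 ap_ge0 bq_ge0 LXO LYO mRn) => C e C0 e0.
    have e20 : 0 < e / 2 by rewrite divr_gt0.
    near=> pq.
    have Hpq : forall w, regular (M := M pq.1 pq.2) (C * ap pq.1) (C * bq pq.2) w ->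
      `|Rn pq.1 pq.2 w| <= K * C ^+ 3 * (tau (M pq.1 pq.2) * ap pq.1 ^+ 2 * bq pq.2
        + tau (M pq.1 pq.2) * ap pq.1 * bq pq.2 ^+ 2) by near: pq; exact: RnE.
    (* Relative to [tau * ap * bq] the bound is a multiple of [ap + bq], which tends to 0. *)
    have h1 : K * C ^+ 3 * ap pq.1 <= e / 2 by near: pq; exact: near_pq_small1.
    have h2 : K * C ^+ 3 * bq pq.2 <= e / 2 by near: pq; exact: near_pq_small2.
    move=> w /Hpq /le_trans; apply.
    have tab := tab_ge0 1%N 1%N pq.1 pq.2.
    rewrite [X in _ <= _ * X]ger0_norm //.
    rewrite [leLHS](_ : _ = (K * C ^+ 3 * ap pq.1 + K * C ^+ 3 * bq pq.2) *
      (tau (M pq.1 pq.2) * ap pq.1 * bq pq.2)); last ring.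
    by rewrite ler_wpM2r //; lra.
Unshelve. all: by end_near. Qed.
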